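(* Let $f:\mathbb{R}^n\to\mathbb{R}$ and let $\{\mathbf{x}_t\}_{t\in\mathbb{N}}$ be the sequence generated by the SZGD algorithm applied to $f$, such that the standing assumptions (i)–(v) listed in the context hold; in particular $f$ is $L$-smooth and is a differentiable Łojasiewicz function with exponent $\theta\in(0,1)$. Let $\mathbf{x}_\infty$ be the almost sure limit of $\{\mathbf{x}_t\}_t$. Suppose the step sizes $\eta_t$ are such that there exist $\eta_-,\eta_+\in(0,\infty)$ with $\eta_-\le\eta_t\le\eta_+$ for all $t$. Then: (a) if $\theta\in(0,\frac12]$, $-1\le \frac{Ln\eta_-^2}{2k}-\eta_-<0$ and $-1\le\frac{Ln\eta_+^2}{2k}-\eta_+<0$, there exists a constant $Q>1$ such that $\{Q^t\|\mathbf{x}_t-\mathbf{x}_\infty\|\}_t$ converges to $0$ in expectation, i.e. $\lim_{t\to\infty}\mathbb{E}\left[Q^t\|\mathbf{x}_t-\mathbf{x}_\infty\|\right]=0$; (b) if $\theta\in(\frac12,1)$ and $\eta_-,\eta_+\in\left(0,\frac{2k}{Ln}\right)$, then $\{\|\mathbf{x}_t-\mathbf{x}_\infty\|\}_t$ converges to $0$ at rate $O\left(t^{\frac{1-\theta}{1-2\theta}}\right)$ in expectation, i.e. $\mathbb{E}\left[\|\mathbf{x}_t-\mathbf{x}_\infty\|\right]=O\left(t^{\frac{1-\theta}{1-2\theta}}\right)$ as $t\to\infty$.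
   Context: $\|\cdot\|$ is the Euclidean norm. A critical point of a differentiable $f$ is a point where $\nabla f$ vanishes. $L$-smooth: $f:\mathbb{R}^n\to\mathbb{R}$ is $L$-smooth if it is continuously differentiable and $\|\nabla f(\mathbf{x})-\nabla f(\mathbf{x}')\|\le L\|\mathbf{x}-\mathbf{x}'\|$ for all $\mathbf{x},\mathbf{x}'\in\mathbb{R}^n$. Łojasiewicz function: a differentiable $f$ is a (differentiable) Łojasiewicz function with Łojasiewicz exponent $\theta\in(0,1)$ if for any $\mathbf{x}^*$ with $\nabla f(\mathbf{x}^* )=0$ there exist constants $\kappa,\mu>0$ such that $|f(\mathbf{x})-f(\mathbf{x}^* )|^\theta\le\kappa\|\nabla f(\mathbf{x})\|$ for all $\mathbf{x}$ with $\|\mathbf{x}-\mathbf{x}^*\|\le\mu$. SZGD (Stochastic Zeroth-order Gradient Descent): fix integers $1\le k\le n$, an initial point $\mathbf{x}_0\in\mathbb{R}^n$, $\delta_0=1$ (or $\delta_0\in(0,1)$), and step sizes $\eta_t>0$. Let $\mathrm{St}(n,k)=\{\mathbf{X}\in\mathbb{R}^{n\times k}:\mathbf{X}^\top\mathbf{X}=\mathbf{I}_k\}$. For $t=0,1,2,\dots$: sample (independently of the past) $\mathbf{V}_t=[\mathbf{v}_{t,1},\dots,\mathbf{v}_{t,k}]$ uniformly from $\mathrm{St}(n,k)$, set $$\widehat{\nabla}f_{\mathbf{V}_t}^{\delta_t}(\mathbf{x}_t)=\frac{n}{2\delta_t k}\sum_{i=1}^k\left(f(\mathbf{x}_t+\delta_t\mathbf{v}_{t,i})-f(\mathbf{x}_t-\delta_t\mathbf{v}_{t,i})\right)\mathbf{v}_{t,i},$$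 $\mathbf{x}_{t+1}=\mathbf{x}_t-\eta_t\widehat{\nabla}f_{\mathbf{V}_t}^{\delta_t}(\mathbf{x}_t)$, and $\delta_{t+1}=\delta_t/2$. Standing assumptions: (i) $f$ is $L$-smooth for some constant $L>0$; (ii) $f$ is a differentiable Łojasiewicz function with exponent $\theta$; (iii) $\inf_{\mathbf{x}\in\mathbb{R}^n}f(\mathbf{x})>-\infty$; (iv) all critical points of $f$ are isolated; (v) there exists a critical point $\mathbf{x}^*$ of $f$ such that the SZGD sequence satisfies $\|\mathbf{x}_t-\mathbf{x}^*\|\le\mu$ for all $t$, where $\mu$ is the radius in the Łojasiewicz inequality at $\mathbf{x}^*$. *)

(* Defs.v *)
From mathcomp Require Import all_boot all_order all_algebra.
From mathcomp Require Import all_classical all_reals all_analysis.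
Import Order.TTheory GRing.Theory Num.Theory.
Import numFieldNormedType.Exports.

Set Implicit Arguments.
Unset Strict Implicit.
Unset Printing Implicit Defensive.

Local Open Scope classical_set_scope.
Local Open Scope ring_scope.

(* The norm that MathComp-Analysis puts on matrices is the sup norm; it gives
   the topology and the notion of differentiability, which do not depend on the
   choice of a norm. *)
Definition enorm (R : realType) (n : nat) (x : 'cV[R]_n) : R :=
  Num.sqrt (\sum_(i < n) x i ord0 ^+ 2).

Definition grad (R : realType) (n : nat) (f : 'cV[R]_n -> R) (x : 'cV[R]_n) :
    'cV[R]_n :=
  \col_i 'D_(delta_mx i ord0) f x.

Definition critical (R : realType) (n : nat) (f : 'cV[R]_n -> R) :
    set 'cV[R]_n :=
  [set x | differentiable f x /\ grad f x = 0].

Definition smooth (R : realType) (n : nat) (L : R) (f : 'cV[R]_n -> R) : Prop :=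
  [/\ forall x, differentiable f x,
      continuous (grad f) &
      forall x y, enorm (grad f x - grad f y) <= L * enorm (x - y)].

Definition lojasiewicz_at (R : realType) (n : nat) (theta : R)
    (f : 'cV[R]_n -> R) (xstar : 'cV[R]_n) (kappa mu : R) : Prop :=
  forall x, enorm (x - xstar) <= mu ->
    `|f x - f xstar| `^ theta <= kappa * enorm (grad f x).

Definition lojasiewicz (R : realType) (n : nat) (theta : R)
    (f : 'cV[R]_n -> R) : Prop :=
  [/\ 0 < theta < 1,
      forall x, differentiable f x &
      forall xstar, critical f xstar ->
        exists kappa mu : R,
          [/\ 0 < kappa, 0 < mu & lojasiewicz_at theta f xstar kappa mu]].

Notation borel_mx R m n := (g_sigma_algebraType (@open 'M[R]_(m, n))).

Definition stiefel (R : realType) (n k : nat) : set 'M[R]_(n, k) :=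
  [set X | X^T *m X = 1%:M].

(* The orthogonal group acts transitively on the Stiefel manifold by left
   multiplication, and the uniform distribution is the unique probability
   measure carried by the manifold that is invariant under this action. *)
Definition uniform_stiefel (R : realType) (n k : nat)
    (mu : probability (borel_mx R n k) R) : Prop :=
  mu (@stiefel R n k) = 1%E /\
  forall Q : 'M[R]_n, Q^T *m Q = 1%:M ->
    forall A : set (borel_mx R n k), measurable A ->
      mu (mulmx Q @^-1` A) = mu A.

Definition mutually_independent (d d' : measure_display)
    (T : measurableType d) (T' : measurableType d') (R : realType)
    (P : probability T R) (X : nat -> T -> T') : Prop :=
  forall (s : seq nat) (A : nat -> set T'),
    uniq s -> (forall t, measurable (A t)) ->
    P (\bigcap_(t in [set` s]) (X t @^-1` A t)) =
    (\prod_(t <- s) P (X t @^-1` A t))%E.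

Definition zo_grad (R : realType) (n k : nat) (f : 'cV[R]_n -> R) (delta : R)
    (V : 'M[R]_(n, k)) (x : 'cV[R]_n) : 'cV[R]_n :=
  (n%:R / (2 * delta * k%:R)) *:
    \sum_(i < k)
      (f (x + delta *: col i V) - f (x - delta *: col i V)) *: col i V.

Definition szgd_delta (R : realType) (delta0 : R) (t : nat) : R :=
  iter t (fun delta => delta / 2) delta0.

Fixpoint szgd (R : realType) (n k : nat) (f : 'cV[R]_n -> R) (eta : nat -> R)
    (delta0 : R) (x0 : 'cV[R]_n) (V : nat -> 'M[R]_(n, k)) (t : nat) :
    'cV[R]_n :=
  if t is s.+1 then
    let x := szgd f eta delta0 x0 V s in
    x - eta s *: zo_grad f (szgd_delta delta0 s) (V s) x
  else x0.

(* Main.v *)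
Require Import Defs.
From mathcomp Require Import all_boot all_order all_algebra.
From mathcomp Require Import all_classical all_reals all_analysis.
From HB Require Import structures.
From mathcomp Require Import fingroup perm measurable_realfun ring lra.
Import Order.TTheory GRing.Theory Num.Theory.
Import numFieldNormedType.Exports.

Local Open Scope classical_set_scope.
Local Open Scope ring_scope.


(** Write [x_t] for the iterates, [g_t] for the gradient of [f] at [x_t],
    [d_t] for the finite-difference radius and [p_t] for the vector of inner
    products of [g_t] with the columns of [V_t].

    Central differences of a smooth function approximate directional
    derivatives up to [L d_t / 2].  Since the columns of [V_t] are orthonormal,
    the estimated gradient has squared length about [(n/k)^2 |p_t|^2], and its
    inner product with [g_t] is about [(n/k) |p_t|^2].  The quadratic upper
    bound for smooth functions therefore gives, for every orthonormal value of
    [V_t], [f (x_(t+1)) <= f (x_t) - c (n/k) |p_t|^2 / 2 + A d_t^2] as soon as the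
    step sizes lie below [2k/(Ln)] ([zo_descent]); in the same way a step has
    length at most a constant times [sqrt (|p_t|^2 + d_t^2)]
    ([enorm_zo_grad_le]).

    Randomness enters through one identity only, [E |p_t|^2 = (k/n) E |g_t|^2]
    ([E_proj2]): [g_t] depends on the past directions, which are independent of
    [V_t], and the uniform distribution on the Stiefel manifold is invariant
    under reflections and permutations of the coordinates, so that [V_t V_t^T]
    has mean [(k/n) I] ([Rintegral_gram]).

    Put [m_t = E |g_t|^2 + d_t^2] and [Z_t = E f (x_t) - f (xstar) + a d_t^2].
    Then [Z_(t+1) <= Z_t - (c/2) m_t], because the radii decrease geometrically
    and their errors are absorbed by [a d_t^2].  The Lojasiewicz inequality and
    Jensen's inequality give [|Z_t| <= C m_t^r] with [r = 1/(2 theta)] (and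
    [r = 1] when [theta <= 1/2]).  From here on the argument is deterministic.
    [Z] must be positive: otherwise [m] would stay away from zero and [Z] would
    tend to minus infinity ([energy_gt0]).  The concavity of [Z^(1-theta)] then
    bounds [sqrt m_t] by a constant times
    [Z_t^(1-theta) - Z_(t+1)^(1-theta)], whose sum telescopes
    ([sum_sqrt_driver_le]).  Since a multiple of [sqrt m_t] bounds the mean
    length of the step, [E |x_t - x_oo|] is at most a constant times [Z_t^(1-theta)]
    ([E_dist_limit_le]), and [Z_t] decays geometrically when [r = 1]
    ([energy_geometric]) and polynomially when [theta > 1/2]
    ([energy_polynomial]). *)

(** * Decay of an energy controlled by its own decrements *)

Section Decay.
Context {R : realType}.
Implicit Types (m Z : nat -> R) (r theta : R).

(** Bernoulli's inequality for an exponent in [0, 1].  It is the only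
    convexity estimate of the development: Jensen's inequality, the telescoping
    bound and the polynomial rate all follow from it.  It is the weighted
    arithmetic-geometric inequality for [u] and [1], proved by comparing [ln]
    with its tangents. *)
Lemma powR_le_tangent1 (u r : R) : 0 <= u -> 0 <= r <= 1 ->
  u `^ r <= 1 + r * (u - 1).
Proof.
move=> u0 /andP[r0 r1].
have [->|rn1] := eqVneq r 1; first by rewrite powRr1// mul1r addrC subrK.
have A0 : 0 < 1 + r * (u - 1).
  have : 0 <= r * u by rewrite mulr_ge0.
  have : r < 1 by rewrite lt_neqAle rn1.
  lra.
move: u0; rewrite le_eqVlt => /predU1P[<-|u0].
  have [->|rn0] := eqVneq r 0; first by rewrite powRr0 mul0r addr0.
  by rewrite powR0//; lra.
set A := 1 + r * (u - 1) in A0 *.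
have ln_le (y : R) : 0 < y -> ln y <= y - 1.
  by move=> y0; rewrite -{1}[y](subrKC 1) le_ln1Dx//; lra.
rewrite -ler_ln ?posrE ?powR_gt0// ln_powR.
have h1 := ln_le (u / A) (divr_gt0 u0 A0).
have h2 := ln_le A^-1; rewrite invr_gt0 in h2; have {}h2 := h2 A0.
rewrite ln_div ?posrE// in h1; rewrite lnV ?posrE// in h2.
have e : r * (u / A - 1) + (1 - r) * (A^-1 - 1) = 0.
  have -> : r * (u / A - 1) + (1 - r) * (A^-1 - 1) =
    (1 + r * (u - 1)) / A - 1 by field; exact: lt0r_neq0.
  by rewrite divff ?subrr// lt0r_neq0.
have g1 : r * (ln u - ln A) <= r * (u / A - 1) by rewrite ler_wpM2l.
have g2 : (1 - r) * (- ln A) <= (1 - r) * (A^-1 - 1).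
  by rewrite ler_wpM2l// subr_ge0.
lra.
Qed.

Lemma powR_sub_ge (a b r : R) : 0 < a -> 0 <= b -> 0 <= r <= 1 ->
  r * (a - b) * a `^ (r - 1) <= a `^ r - b `^ r.
Proof.
move=> a0 b0 r01.
have a_neq0 : a != 0 by rewrite gt_eqF.
have h := powR_le_tangent1 (b / a) r (divr_ge0 b0 (ltW a0)) r01.
have -> : b `^ r = a `^ r * (b / a) `^ r.
  by rewrite -powRM ?(ltW a0) ?divr_ge0 ?(ltW a0)// mulrC divfK.
rewrite powRB ?a_neq0 ?implybT// powRr1 ?(ltW a0)//.
have -> : r * (a - b) * (a `^ r / a) = a `^ r * (r * (1 - b / a)).
  by field.
rewrite -{2}[a `^ r]mulr1 -mulrBr ler_wpM2l ?powR_ge0//; lra.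
Qed.

(** [Z] is the energy and [m] the squared driver that makes it decrease.  The
    bound [Zm] is a Lojasiewicz inequality in integrated form: a large energy
    forces a large driver. *)
Section Sequence.
Variables (m Z : nat -> R) (c C r B : R).
Hypotheses (c0 : 0 < c) (C0 : 0 < C) (r0 : 0 < r).
Hypothesis m0 : forall t, 0 < m t.
Hypothesis decr : forall t, Z t.+1 <= Z t - c * m t.
Hypothesis Zm : forall t, `|Z t| <= C * m t `^ r.
Hypothesis Zlb : forall t, B <= Z t.

Lemma powR_le_driver t : (`|Z t| / C) `^ r^-1 <= m t.
Proof.
have -> : m t = (m t `^ r) `^ r^-1.
  by rewrite -powRrM divff ?gt_eqF// powRr1// ltW.
apply: ge0_ler_powR; rewrite ?nnegrE ?invr_ge0 ?(ltW r0) ?powR_ge0//.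
  by rewrite divr_ge0// ltW.
by rewrite ler_pdivrMr// mulrC.
Qed.

Lemma energy_decr s t : (s <= t)%N -> Z t <= Z s.
Proof.
move=> /subnK <-; elim: (t - s)%N => // j IH.
apply: le_trans IH; rewrite addSn.
by apply: le_trans (decr _) _; rewrite gerBl mulr_ge0// ltW.
Qed.

(** A nonpositive energy would become negative one step later and stay below a
    negative constant, so [m] would stay above a positive one and the energy
    would decrease at least linearly, against the lower bound [B]. *)
Lemma energy_gt0 t : 0 < Z t.
Proof.
rewrite ltNge; apply/negP => Zt.
have Zn : Z t.+1 < 0.
  by apply: le_lt_trans (decr t) _; rewrite subr_lt0 (le_lt_trans Zt) ?mulr_gt0.
pose b := (`|Z t.+1| / C) `^ r^-1.
have b0 : 0 < b by rewrite powR_gt0// divr_gt0// normr_gt0 lt_eqF.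
have bm j : b <= m (j + t.+1)%N.
  apply: le_trans (powR_le_driver _).
  apply: ge0_ler_powR; rewrite ?nnegrE ?invr_ge0 ?(ltW r0) ?divr_ge0 ?(ltW C0)//.
  rewrite ler_pM2r ?invr_gt0//.
  have := energy_decr _ _ (leq_addl j t.+1) => h.
  by rewrite !ltr0_norm ?lerN2// (le_lt_trans h).
have lin j : Z (j + t.+1)%N <= - (c * b) *+ j.
  elim: j => [|j IH]; first by rewrite mulr0n add0n ltW.
  rewrite addSn (le_trans (decr _))// mulrSr lerD// lerN2 ler_pM2l//.
have [j] : exists j : nat, - B < c * b * j%:R.
  exists (Num.truncn (`|B| / (c * b))).+1.
  apply: le_lt_trans (ler_norm _) _; rewrite normrN.
  by rewrite mulrC -ltr_pdivrMr ?mulr_gt0// truncnS_gt.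
move=> hj; have := le_trans (Zlb _) (lin j).
by rewrite mulNrn -mulr_natr lerNr leNgt hj.
Qed.

(** The Kurdyka-Lojasiewicz argument: [Z^(1-theta)] decreases at least by
    [(1-theta) Z^(-theta) (Z_t - Z_(t+1))], hence by a multiple of
    [Z^(-theta) m], and [Z^theta] is itself at most a multiple of [sqrt m]. *)
Lemma sqrt_driver_le (theta : R) t : 0 < theta < 1 -> r * theta = 2^-1 ->
  Num.sqrt (m t) <= C `^ theta / (c * (1 - theta)) *
    (Z t `^ (1 - theta) - Z t.+1 `^ (1 - theta)).
Proof.
move=> /andP[th0 th1] rth.
have Zt := energy_gt0 t.
have th1' : 0 < 1 - theta by rewrite subr_gt0.
have h : (1 - theta) * (Z t - Z t.+1) * Z t `^ (1 - theta - 1) <=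
    Z t `^ (1 - theta) - Z t.+1 `^ (1 - theta).
  by apply: powR_sub_ge => //; [exact/ltW/energy_gt0|lra].
rewrite addrAC subrr sub0r powRN in h.
have {}h : (1 - theta) * (c * m t) / Z t `^ theta <=
    Z t `^ (1 - theta) - Z t.+1 `^ (1 - theta).
  apply: le_trans h; rewrite ler_pM2r ?invr_gt0 ?powR_gt0//.
  by rewrite ler_pM2l//; have := decr t; lra.
have Zth : Z t `^ theta <= C `^ theta * Num.sqrt (m t).
  rewrite -powR12_sqrt ?(ltW (m0 t))// -rth powRrM -powRM ?powR_ge0 ?(ltW C0)//.
  apply: ge0_ler_powR; rewrite ?nnegrE ?(ltW th0) ?(ltW Zt)//.
    by rewrite mulr_ge0 ?powR_ge0// ltW.
  by rewrite (le_trans _ (Zm t))// ler_norm.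
have s0 : 0 < Num.sqrt (m t) by rewrite sqrtr_gt0.
rewrite mulrAC ler_pdivlMr ?mulr_gt0//.
rewrite ler_pdivrMr ?powR_gt0// in h.
rewrite -(ler_pM2r s0).
have -> : Num.sqrt (m t) * (c * (1 - theta)) * Num.sqrt (m t) =
  (1 - theta) * (c * m t).
  by rewrite -[in RHS](sqr_sqrtr (ltW (m0 t))); ring.
apply: le_trans h _.
set D := _ - _.
have D0 : 0 <= D.
  rewrite subr_ge0 ge0_ler_powR ?nnegrE ?(ltW th1') ?(ltW (energy_gt0 _))//.
  exact: energy_decr.
by rewrite mulrAC [leLHS]mulrC; rewrite ler_wpM2r.
Qed.

Lemma sum_sqrt_driver_le (theta : R) t T : 0 < theta < 1 ->
  r * theta = 2^-1 -> (t <= T)%N ->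
  \sum_(t <= s < T) Num.sqrt (m s) <=
    C `^ theta / (c * (1 - theta)) * Z t `^ (1 - theta).
Proof.
move=> th rth tT; have /andP[th0 th1] := th.
have K0 : 0 <= C `^ theta / (c * (1 - theta)).
  by rewrite divr_ge0 ?powR_ge0// mulr_ge0 ?(ltW c0)// subr_ge0 ltW.
apply: le_trans (ler_sum_nat (fun s _ => sqrt_driver_le theta s th rth)) _.
rewrite -mulr_sumr ler_wpM2l//.
rewrite (_ : \sum_(t <= s < T) _ = - \sum_(t <= s < T)
    (Z s.+1 `^ (1 - theta) - Z s `^ (1 - theta))); last first.
  by rewrite -sumrN; apply: eq_bigr => s _; rewrite opprB.
by rewrite telescope_sumr// opprB gerBl powR_ge0.
Qed.

(** With [r = 1] the decrement is at least a fixed fraction of the energy; that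
    fraction is below one because the energy remains positive. *)
Lemma energy_geometric : r = 1 ->
  exists2 q, 0 < q < 1 & forall t, Z t <= Z 0%N * q ^+ t.
Proof.
move=> r1; exists (1 - c / C).
  rewrite ltrBlDr ltrDl divr_gt0// andbT.
  have h := decr 0; have hm := Zm 0; have Z1 := energy_gt0 1.
  rewrite r1 powRr1 ?(ltW (m0 _))// gtr0_norm ?energy_gt0// in hm.
  have : c * m 0 < C * m 0 by lra.
  by rewrite ltr_pM2r// subr_gt0 ltr_pdivrMr// mul1r.
have step t : Z t.+1 <= (1 - c / C) * Z t.
  apply: le_trans (decr t) _; have hm := Zm t.
  rewrite r1 powRr1 ?(ltW (m0 _))// gtr0_norm ?energy_gt0// in hm.
  rewrite mulrBl mul1r lerD2l lerN2 -mulrA ler_pM2l// mulrC ler_pdivrMr//.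
  by rewrite mulrC.
elim=> [|t IH]; first by rewrite expr0 mulr1.
apply: le_trans (step t) _; rewrite exprS mulrCA ler_wpM2l//.
have := step t; have := energy_gt0 t.+1; have := energy_gt0 t.
move=> p1 p2 p3; have : 0 < (1 - c / C) * Z t by exact: lt_le_trans p3.
by rewrite pmulr_lgt0// => /ltW.
Qed.

(** The inverse of [Z^(2 theta - 1)] grows at least linearly: one step
    multiplies [Z^(2 theta - 1)] by at most [1 - b Z^(2 theta - 1)]. *)
Lemma energy_polynomial (theta : R) : 1 / 2 < theta < 1 -> r * theta = 2^-1 ->
  exists2 K, 0 < K & forall t, (0 < t)%N ->
    Z t `^ (1 - theta) <= K * t%:R `^ ((1 - theta) / (1 - 2 * theta)).
Proof.
move=> /andP[thl thu] rth.
pose a := 2 * theta - 1.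
have a0 : 0 < a by rewrite /a; lra.
have a1 : 0 <= a <= 1 by rewrite /a; lra.
have rV : r^-1 = a + 1.
  have th0 : theta != 0 by rewrite gt_eqF//; lra.
  have rn0 : r != 0 by rewrite gt_eqF.
  have -> : r^-1 = 2 * (r * theta) / r by rewrite rth; field.
  by rewrite /a; field.
pose b := a * (c / C `^ (a + 1)).
have b0 : 0 < b by rewrite mulr_gt0// divr_gt0// powR_gt0.
have step t : Z t.+1 `^ a <= Z t `^ a - b * (Z t `^ a) ^+ 2.
  have Zt := energy_gt0 t; have Z1 := energy_gt0 t.+1.
  have h := powR_sub_ge (Z t) (Z t.+1) a Zt (ltW Z1) a1.
  rewrite lerBrDr -lerBrDl; apply: le_trans h.
  have Zn0 : Z t != 0 by rewrite gt_eqF.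
  rewrite (@powRB _ (Z t) a 1) ?Zn0 ?implybT// (@powRr1 _ (Z t)) ?(ltW Zt)//.
  have hm := powR_le_driver t; rewrite rV gtr0_norm// in hm.
  rewrite powRM ?(ltW Zt) ?invr_ge0 ?(ltW C0)// in hm.
  have hd := decr t.
  have {}hd : c * (Z t `^ (a + 1) * C^-1 `^ (a + 1)) <= Z t - Z t.+1.
    have : c * (Z t `^ (a + 1) * C^-1 `^ (a + 1)) <= c * m t by rewrite ler_pM2l.
    lra.
  apply: le_trans (_ : a * (c * (Z t `^ (a + 1) * C^-1 `^ (a + 1))) *
    (Z t `^ a / Z t) <= _).
    rewrite (@powRD _ (Z t) a 1) ?Zn0 ?implybT// (@powRr1 _ (Z t)) ?(ltW Zt)//.
    rewrite -(powR_inv1 (ltW C0)) -powRrM mulN1r powRN /b.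
    rewrite le_eqVlt; apply/orP; left; apply/eqP; field.
    by rewrite gt_eqF//= gt_eqF// powR_gt0.
  by rewrite ler_pM2r ?divr_gt0 ?powR_gt0// ler_pM2l.
have inv_lin t : b * t%:R <= (Z t `^ a)^-1.
  elim: t => [|t IH]; first by rewrite mulr0 invr_ge0 powR_ge0.
  have A0 : 0 < Z t `^ a by rewrite powR_gt0// energy_gt0.
  have A1 : 0 < Z t.+1 `^ a by rewrite powR_gt0// energy_gt0.
  move: (step t) IH A0 A1; set A := Z t `^ a; set A' := Z t.+1 `^ a.
  move=> st IH A0 A1.
  have hA : A' <= A * (1 - b * A) by rewrite mulrBr mulr1 mulrCA -expr2.
  have p0 : 0 < 1 - b * A.
    by have := lt_le_trans A1 hA; rewrite pmulr_rgt0.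
  rewrite -natr1 mulrDr mulr1.
  apply: le_trans (_ : A^-1 + b <= _); first by rewrite lerD2r.
  have hV : (A * (1 - b * A))^-1 <= A'^-1 by rewrite lef_pV2 ?posrE ?mulr_gt0.
  apply: le_trans hV.
  rewrite -[leRHS]mul1r ler_pdivlMr ?mulr_gt0//.
  have -> : (A^-1 + b) * (A * (1 - b * A)) = 1 - (b * A) ^+ 2.
    by field; rewrite gt_eqF.
  by rewrite gerBl sqr_ge0.
clearbody b.
pose e := (1 - theta) / a.
have e0 : 0 < e by rewrite divr_gt0// subr_gt0.
exists (b^-1 `^ e); first by rewrite powR_gt0// invr_gt0.
move=> t t0.
have -> : (1 - theta) / (1 - 2 * theta) = - e.
  rewrite /e (_ : 1 - 2 * theta = - a); last by rewrite /a opprB.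
  by rewrite invrN mulrN.
have -> : Z t `^ (1 - theta) = (Z t `^ a) `^ e.
  by rewrite -powRrM /e mulrC divfK ?gt_eqF.
have t0' : 0 < t%:R :> R by rewrite ltr0n.
have -> : t%:R `^ (- e) = t%:R^-1 `^ e.
  by rewrite -(powR_inv1 (ltW t0')) -powRrM mulN1r.
rewrite -powRM ?invr_ge0 ?(ltW t0') ?(ltW b0)//.
apply: ge0_ler_powR; rewrite ?nnegrE ?(ltW e0) ?powR_ge0//.
  by rewrite mulr_ge0// invr_ge0 ltW.
rewrite -invfM -[leLHS]invrK lef_pV2 ?posrE ?mulr_gt0//.
by rewrite invr_gt0 powR_gt0// energy_gt0.
Qed.

End Sequence.
End Decay.

(** * The Euclidean norm *)

Section Euclid.
Context {R : realType}.

Definition dot {n} (u v : 'cV[R]_n) : R := \sum_(i < n) u i ord0 * v i ord0.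

Lemma dotE {n} (u v : 'cV[R]_n) : dot u v = (u^T *m v) ord0 ord0.
Proof. by rewrite mxE; apply: eq_bigr => i _; rewrite mxE. Qed.

Lemma dotC {n} (u v : 'cV[R]_n) : dot u v = dot v u.
Proof. by apply: eq_bigr => i _; rewrite mulrC. Qed.

Lemma dotDr {n} (u v w : 'cV[R]_n) : dot u (v + w) = dot u v + dot u w.
Proof. by rewrite !dotE mulmxDr mxE. Qed.

Lemma dotZr {n} a (u v : 'cV[R]_n) : dot u (a *: v) = a * dot u v.
Proof. by rewrite !dotE -scalemxAr mxE. Qed.

Lemma dotZl {n} a (u v : 'cV[R]_n) : dot (a *: u) v = a * dot u v.
Proof. by rewrite dotC dotZr dotC. Qed.

Lemma dotNr {n} (u v : 'cV[R]_n) : dot u (- v) = - dot u v.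
Proof. by rewrite -scaleN1r dotZr mulN1r. Qed.

Lemma dotBl {n} (u v w : 'cV[R]_n) : dot (u - v) w = dot u w - dot v w.
Proof. by rewrite dotC dotDr dotNr !(dotC w). Qed.

Lemma enormE {n} (u : 'cV[R]_n) : enorm u = Num.sqrt (dot u u).
Proof. by rewrite /enorm; congr Num.sqrt; apply: eq_bigr => i _; rewrite expr2. Qed.

Lemma dot_ge0 {n} (u : 'cV[R]_n) : 0 <= dot u u.
Proof. by apply: sumr_ge0 => i _; rewrite -expr2 sqr_ge0. Qed.

Lemma sqr_enorm {n} (u : 'cV[R]_n) : enorm u ^+ 2 = dot u u.
Proof. by rewrite enormE sqr_sqrtr ?dot_ge0. Qed.

Lemma enorm_ge0 {n} (u : 'cV[R]_n) : 0 <= enorm u.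
Proof. by rewrite sqrtr_ge0. Qed.

Lemma enormZ {n} a (u : 'cV[R]_n) : enorm (a *: u) = `|a| * enorm u.
Proof.
by rewrite !enormE dotZr dotZl mulrA -expr2 sqrtrM ?sqr_ge0// sqrtr_sqr.
Qed.

Lemma enormN {n} (u : 'cV[R]_n) : enorm (- u) = enorm u.
Proof. by rewrite -scaleN1r enormZ normrN1 mul1r. Qed.

Lemma enormBC {n} (u v : 'cV[R]_n) : enorm (u - v) = enorm (v - u).
Proof. by rewrite -enormN opprB. Qed.

Lemma le_entry_enorm {n} (u : 'cV[R]_n) i : `|u i ord0| <= enorm u.
Proof.
rewrite -sqrtr_sqr ler_wsqrtr// (bigD1 i)//= lerDl.
by apply: sumr_ge0 => j _; rewrite sqr_ge0.
Qed.

Lemma cauchy_schwarz {n} (u v : 'cV[R]_n) : dot u v <= enorm u * enorm v.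
Proof.
(* Polarization: the gap is half of [a b |u/a - v/b|^2]. *)
have sub (a b : R) : 0 < a -> 0 < b ->
    dot u v <= a * b * (dot u u / a ^+ 2 + dot v v / b ^+ 2) / 2.
  move=> a0 b0; have an0 : a != 0 by rewrite gt_eqF.
  have bn0 : b != 0 by rewrite gt_eqF.
  have -> : a * b * (dot u u / a ^+ 2 + dot v v / b ^+ 2) / 2 =
      dot u v + a * b / 2 * dot (a^-1 *: u - b^-1 *: v) (a^-1 *: u - b^-1 *: v).
    rewrite dotBl !dotDr !dotNr !dotZl !dotZr (dotC v u).
    by field; rewrite bn0.
  by rewrite lerDl mulr_ge0 ?dot_ge0// mulr_ge0// ltW// mulr_gt0.
have zero (w z : 'cV[R]_n) : enorm w = 0 -> dot w z = 0.
  move=> w0; apply: big1 => i _; have := le_entry_enorm w i.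
  by rewrite w0 normr_le0 => /eqP ->; rewrite mul0r.
have [u0|u0] := eqVneq (enorm u) 0; first by rewrite zero// u0 mul0r.
have [v0|v0] := eqVneq (enorm v) 0; first by rewrite dotC zero// v0 mulr0.
have up : 0 < enorm u by rewrite lt_neqAle eq_sym u0 enorm_ge0.
have vp : 0 < enorm v by rewrite lt_neqAle eq_sym v0 enorm_ge0.
apply: le_trans (sub _ _ up vp) _; rewrite -!sqr_enorm.
by rewrite le_eqVlt; apply/orP; left; apply/eqP; field; rewrite v0.
Qed.

Lemma cauchy_schwarz_norm {n} (u v : 'cV[R]_n) : `|dot u v| <= enorm u * enorm v.
Proof.
rewrite ler_norml cauchy_schwarz andbT lerNl -dotNr.
by rewrite (le_trans (cauchy_schwarz _ _))// enormN.
Qed.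

Lemma ler_enormD {n} (u v : 'cV[R]_n) : enorm (u + v) <= enorm u + enorm v.
Proof.
rewrite -ler_sqr ?nnegrE ?addr_ge0 ?enorm_ge0// sqrrD !sqr_enorm.
rewrite dotDr !(dotC (u + v)) !dotDr (dotC v u).
have := cauchy_schwarz u v; rewrite mulr2n; lra.
Qed.

End Euclid.

(** * Smooth functions *)

Section Smooth.
Context {R : realType} {n : nat}.
Variables (f : 'cV[R]_n -> R) (L : R).

Lemma diff_grad (x h : 'cV[R]_n) : differentiable f x -> 'd f x h = dot (grad f x) h.
Proof.
move=> df; have {1}-> : h = \sum_(i < n) h i ord0 *: delta_mx i ord0.
  apply/colP => j; rewrite summxE (bigD1 j)//= big1 ?addr0.
    by rewrite !mxE !eqxx mulr1.
  by move=> i ij; rewrite !mxE eq_sym (negbTE ij) mulr0.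
rewrite linear_sum; apply: eq_bigr => i _.
by rewrite linearZ/= mxE -deriveE// mulrC.
Qed.

Hypothesis fL : smooth L f.

Lemma is_derive_line (x h : 'cV[R]_n) (s : R) :
  is_derive s (1 : R) (fun s : R => f (x + s *: h)) (dot (grad f (x + s *: h)) h).
Proof.
have [df _ _] := fL.
have dl : differentiable (fun s : R => x + s *: h) s by [].
have dc : differentiable (fun s : R => f (x + s *: h)) s.
  exact: (@differentiable_comp _ _ _ _ (fun s : R => x + s *: h) f s dl (df _)).
apply: DeriveDef; first exact/derivable1_diffP.
rewrite deriveE//.
rewrite (@diff_comp _ _ _ _ (fun s : R => x + s *: h) f s dl (df _))/=.
rewrite -diff_grad//; congr ('d f _ _).
by rewrite diff_val/= add0r scale1r.
Qed.

(** The sign [eps] lets one mean value argument serve for the upper and for the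
    lower bound. *)
Lemma smooth_taylor_signed (eps : R) (x h : 'cV[R]_n) : `|eps| <= 1 ->
  eps * (f (x + h) - f x - dot (grad f x) h) <= L / 2 * enorm h ^+ 2.
Proof.
move=> eps1; have [df _ lip] := fL.
(* The derivative of [psi] is nonpositive on [0, 1] by the Lipschitz bound. *)
pose psi (s : R) := eps *: (f (x + s *: h) - s * dot (grad f x) h)
   - (L / 2 * enorm h ^+ 2) * s ^+ 2.
pose dpsi (s : R) := eps * (dot (grad f (x + s *: h)) h - dot (grad f x) h)
   - (L / 2 * enorm h ^+ 2) * (2 * s).
have dpsiE s : is_derive s (1 : R) psi (dpsi s).
  have := is_derive_line x h s => ?.
  rewrite /psi; apply: is_derive_eq.
  by rewrite /dpsi /GRing.scale/=; ring.
have [c] := @MVT R psi dpsi 0 1 ltr01 (fun s _ => dpsiE s)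
  (derivable_within_continuous (fun s _ => @ex_derive _ _ _ _ _ _ _ (dpsiE s))).
rewrite in_itv/= => /andP[c0 c1]; rewrite subr0 mulr1 => E.
have : dpsi c <= 0.
  rewrite /dpsi subr_le0 -dotBl.
  apply: le_trans (ler_norm _) _; rewrite normrM.
  apply: le_trans (_ : 1 * `|dot (grad f (x + c *: h) - grad f x) h| <= _).
    by rewrite ler_wpM2r.
  rewrite mul1r (le_trans (cauchy_schwarz_norm _ _))//.
  apply: le_trans (_ : L * enorm (c *: h) * enorm h <= _).
    rewrite ler_wpM2r ?enorm_ge0// (le_trans (lip _ _))//.
    by rewrite addrAC subrr add0r.
  by rewrite enormZ gtr0_norm// le_eqVlt; apply/orP; left; apply/eqP; field.
rewrite -E /psi !scale1r !scale0r addr0 mul1r mul0r expr1n expr0n/=.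
rewrite mulr1 mulr0 /GRing.scale/=.
move=> h1; rewrite subr0 in h1; rewrite !subr0 in h1; lra.
Qed.

Lemma smooth_taylor (x h : 'cV[R]_n) :
  `|f (x + h) - f x - dot (grad f x) h| <= L / 2 * enorm h ^+ 2.
Proof.
rewrite ler_norml; apply/andP; split; last first.
  by rewrite -[leLHS]mul1r smooth_taylor_signed// normr1.
by rewrite lerNl -mulN1r smooth_taylor_signed// normrN1.
Qed.

(** The first-order Taylor remainders at [delta v] and [- delta v] are each at
    most [L delta^2 / 2], and the difference is divided by [2 delta]. *)
Lemma central_difference (x v : 'cV[R]_n) (delta : R) : 0 < delta ->
  enorm v = 1 ->
  `|(f (x + delta *: v) - f (x - delta *: v)) / (2 * delta) - dot (grad f x) v|
    <= L * delta / 2.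
Proof.
move=> d0 v1.
have h1 := smooth_taylor x (delta *: v).
have h2 := smooth_taylor x (- (delta *: v)).
rewrite dotNr dotZr enormN enormZ (gtr0_norm d0) v1 mulr1 in h2.
rewrite dotZr enormZ (gtr0_norm d0) v1 mulr1 in h1.
move: h1 h2; set a := f (_ + _); set b := f (x - _); set p := dot _ _ => h1 h2.
have d2 : 0 < 2 * delta by rewrite mulr_gt0.
have -> : (a - b) / (2 * delta) - p =
  ((a - f x - delta * p) - (b - f x - - (delta * p))) / (2 * delta).
  by field; rewrite gt_eqF.
rewrite normrM [`|_^-1|]gtr0_norm ?invr_gt0// ler_pdivrMr//.
apply: le_trans (ler_normB _ _) _; apply: le_trans (lerD h1 h2) _.
by rewrite le_eqVlt; apply/orP; left; apply/eqP; field.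
Qed.

End Smooth.

(** * One step of the method *)

Section OneStep.
Context {R : realType} {n k : nat}.
Variables (f : 'cV[R]_n -> R) (L : R).
Hypotheses (L0 : 0 < L) (fL : smooth L f) (k0 : (0 < k)%N) (n0 : (0 < n)%N).

(** The squared length of [V^T u], which is that of the orthogonal projection
    of [u] on the column space of [V] when the columns are orthonormal. *)
Definition proj2 (u : 'cV[R]_n) (V : 'M[R]_(n, k)) : R :=
  \sum_(i < k) dot u (col i V) ^+ 2.

Lemma proj2_ge0 u V : 0 <= proj2 u V.
Proof. by apply: sumr_ge0 => i _; rewrite sqr_ge0. Qed.

(** This form separates [u] from [V], so that expectations factor when the two
    are independent. *)
Lemma proj2E u V :
  proj2 u V = \sum_(i < n) \sum_(j < n) u i ord0 * u j ord0 * (V *m V^T) i j.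
Proof.
rewrite /proj2.
under [RHS]eq_bigr => i _ do under eq_bigr => j _ do rewrite mxE mulr_sumr.
under [RHS]eq_bigr => i _ do rewrite exchange_big.
rewrite [RHS]exchange_big; apply: eq_bigr => l _ /=.
rewrite expr2 /dot mulr_suml; apply: eq_bigr => i _.
by rewrite mulr_sumr; apply: eq_bigr => j _; rewrite !mxE; ring.
Qed.

Lemma dot_mulmx_stiefel (V : 'M[R]_(n, k)) (u v : 'cV[R]_k) : stiefel V ->
  dot (V *m u) (V *m v) = dot u v.
Proof.
by move=> hV; rewrite !dotE trmx_mul -mulmxA (mulmxA V^T) hV mul1mx.
Qed.

Lemma enorm_col_stiefel (V : 'M[R]_(n, k)) i : stiefel V ->
  enorm (col i V) = 1.
Proof.
move=> hV; rewrite colE enormE dot_mulmx_stiefel// dotE trmx_delta mul_delta_mx.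
by rewrite mxE !eqxx sqrtr1.
Qed.

Section Step.
Variables (x : 'cV[R]_n) (V : 'M[R]_(n, k)) (delta : R).
Hypotheses (delta0 : 0 < delta) (hV : stiefel V).

(* [q] collects the central differences, [p] the directional derivatives that
   they approximate. *)
Let q : 'cV[R]_k := \col_i
  ((f (x + delta *: col i V) - f (x - delta *: col i V)) / (2 * delta)).
Let p i := dot (grad f x) (col i V).
Let kappa : R := n%:R / k%:R.

Let kappa0 : 0 < kappa. Proof. by rewrite divr_gt0 ?ltr0n. Qed.

Let zo_gradE : zo_grad f delta V x = kappa *: (V *m q).
Proof.
have -> : V *m q = \sum_(i < k) q i ord0 *: col i V.
  apply/colP => j; rewrite summxE mxE; apply: eq_bigr => i _.
  by rewrite !mxE mulrC.
rewrite /zo_grad !scaler_sumr; apply: eq_bigr => i _; rewrite !scalerA.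
rewrite mxE; congr (_ *: _); rewrite /kappa; field.
by rewrite !gt_eqF ?ltr0n.
Qed.

Let qp i : (q i ord0 - p i) ^+ 2 <= L ^+ 2 / 4 * delta ^+ 2.
Proof.
have := central_difference f L fL x (col i V) delta delta0.
move=> /(_ (enorm_col_stiefel V i hV)); rewrite mxE => h.
rewrite -real_normK ?num_real//.
have -> : L ^+ 2 / 4 * delta ^+ 2 = (L * delta / 2) ^+ 2 by field.
by rewrite ler_sqr// ?nnegrE ?normr_ge0 ?divr_ge0 ?mulr_ge0 ?(ltW L0) ?(ltW delta0).
Qed.

Lemma enorm_zo_grad_le :
  enorm (zo_grad f delta V x) <= n%:R / k%:R * Num.sqrt (2 + k%:R * L ^+ 2) *
    Num.sqrt (proj2 (grad f x) V + delta ^+ 2).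
Proof.
rewrite zo_gradE enormZ (gtr0_norm kappa0) -mulrA ler_pM2l//.
rewrite -sqrtrM; last by rewrite addr_ge0// mulr_ge0 ?sqr_ge0.
rewrite enormE dot_mulmx_stiefel// ler_wsqrtr//.
apply: le_trans (_ : \sum_(i < k) (2 * p i ^+ 2 + L ^+ 2 * delta ^+ 2) <= _).
  apply: ler_sum => i _; have := qp i; set a := q _ _; set b := p i => h.
  have L2d : 0 <= L ^+ 2 * delta ^+ 2 by rewrite mulr_ge0 ?sqr_ge0.
  have : 0 <= (a - 2 * b) ^+ 2 by exact: sqr_ge0.
  nra.
rewrite big_split/= -mulr_sumr -/(proj2 (grad f x) V) sumr_const card_ord.
rewrite -mulr_natl; have := proj2_ge0 (grad f x) V.
have : 0 <= k%:R * L ^+ 2 by rewrite mulr_ge0 ?sqr_ge0.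
move: (sqr_ge0 delta) (proj2 _ _) => d2 S kL S0.
rewrite mulrDr !mulrDl.
have : 0 <= k%:R * L ^+ 2 * S by rewrite mulr_ge0.
by rewrite mulrA; lra.
Qed.

(** With [e = q - p], the quadratic upper bound of [f] is a sum over the columns
    of [- (c kappa) p^2] plus terms in [p e] and [e^2].  Half of the decrease
    pays for the cross term, which leaves an error of order [delta^2].  The
    constant [c] bounds [eta (1 - L kappa eta / 2)] from below over the allowed
    range of step sizes. *)
Lemma zo_descent (eta elo ehi c : R) : 0 < elo -> elo <= eta <= ehi ->
  L * kappa * ehi < 2 ->
  c = elo * (1 - L * kappa * ehi / 2) ->
  f (x - eta *: zo_grad f delta V x) <= f x - kappa * (c / 2) * proj2 (grad f x) V
   + kappa * (ehi ^+ 2 / (2 * c) + ehi) * k%:R * (L ^+ 2 / 4) * delta ^+ 2.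
Proof.
move=> elo0 /andP[eta1 eta2] Lke cE.
have eta0 : 0 < eta by exact: lt_le_trans eta1.
have ehi0 : 0 < ehi by exact: lt_le_trans eta2.
have Lk : 0 < L * kappa by rewrite mulr_gt0.
have c0 : 0 < c by rewrite cE mulr_gt0//; lra.
have Lke2 : L * kappa * eta <= L * kappa * ehi by rewrite ler_pM2l.
have c_le : c <= eta * (1 - L * kappa * eta / 2).
  rewrite cE; apply: ler_pM; rewrite ?(ltW elo0)//; lra.
have ty := smooth_taylor f L fL x (- (eta *: zo_grad f delta V x)).
have {ty} := le_trans (ler_norm _) ty.
rewrite dotNr dotZr enormN enormZ gtr0_norm// exprMn.
rewrite zo_gradE dotZr enormZ gtr0_norm// exprMn sqr_enorm dot_mulmx_stiefel//.
have -> : dot (grad f x) (V *m q) = \sum_(i < k) p i * q i ord0.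
  rewrite dotE mulmxA mxE; apply: eq_bigr => i _; congr (_ * _).
  rewrite mxE /p /dot; apply: eq_bigr => j _.
  by rewrite !mxE.
rewrite [dot q q]/dot => ty.
have key i : - (eta * kappa) * (p i * q i ord0) +
   L / 2 * (eta ^+ 2 * kappa ^+ 2) * (q i ord0 * q i ord0) <=
   - (kappa * (c / 2)) * p i ^+ 2 +
   kappa * (ehi ^+ 2 / (2 * c) + ehi) * (L ^+ 2 / 4 * delta ^+ 2).
  have he := qp i; move: he; rewrite -[X in (X - _)^+2](subrK (p i)).
  set e := q i ord0 - p i; rewrite addrK => he.
  have -> : q i ord0 = p i + e by rewrite /e addrC subrK.
  move: (p i) => P.
  apply: le_trans (_ : - (kappa * (c / 2)) * P ^+ 2 +
     kappa * (ehi ^+ 2 / (2 * c) + ehi) * e ^+ 2 <= _); last first.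
    rewrite lerD2l ler_wpM2l// mulr_ge0 ?(ltW kappa0)// addr_ge0 ?(ltW ehi0)//.
    by rewrite divr_ge0 ?sqr_ge0// mulr_ge0// ltW.
  have -> : - (eta * kappa) * (P * (P + e)) +
    L / 2 * (eta ^+ 2 * kappa ^+ 2) * ((P + e) * (P + e)) =
    kappa * (- (eta * (1 - L * kappa * eta / 2)) * P ^+ 2 +
      (eta * (L * kappa * eta - 1)) * (P * e) +
      (eta * (L * kappa * eta / 2)) * e ^+ 2).
    by field.
  have -> : - (kappa * (c / 2)) * P ^+ 2 +
      kappa * (ehi ^+ 2 / (2 * c) + ehi) * e ^+ 2 =
    kappa * (- (c / 2) * P ^+ 2 + (ehi ^+ 2 / (2 * c) + ehi) * e ^+ 2).
    by ring.
  rewrite ler_pM2l//.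
  have a1 : - (eta * (1 - L * kappa * eta / 2)) * P ^+ 2 <= - c * P ^+ 2.
    by rewrite ler_wpM2r ?sqr_ge0// lerN2.
  have a3 : eta * (L * kappa * eta / 2) * e ^+ 2 <= ehi * e ^+ 2.
    rewrite ler_wpM2r ?sqr_ge0//.
    have : eta * (L * kappa * eta / 2) <= eta * 1 by rewrite ler_pM2l//; lra.
    lra.
  have a2 : (eta * (L * kappa * eta - 1)) * (P * e) <=
      c / 2 * P ^+ 2 + ehi ^+ 2 / (2 * c) * e ^+ 2.
    apply: le_trans (_ : ehi * `|P * e| <= _).
      apply: le_trans (ler_norm _) _; rewrite normrM ler_wpM2r// normrM.
      rewrite gtr0_norm//.
      have Lke0 : 0 < L * kappa * eta by rewrite mulr_gt0.
      have : `|L * kappa * eta - 1| <= 1 by rewrite ler_norml; lra.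
      move=> h; apply: le_trans (_ : eta * 1 <= _); last by rewrite mulr1.
      by rewrite ler_wpM2l// ltW.
    rewrite normrM -(real_normK (num_real P)) -(real_normK (num_real e)).
    have -> : c / 2 * `|P| ^+ 2 + ehi ^+ 2 / (2 * c) * `|e| ^+ 2 =
      ehi * (`|P| * `|e|) + (c * `|P| - ehi * `|e|) ^+ 2 / (2 * c).
      by field; rewrite gt_eqF.
    by rewrite lerDl divr_ge0 ?sqr_ge0// mulr_ge0// ltW.
  lra.
have := @ler_sum _ _ (index_enum 'I_k) xpredT _ _ (fun i _ => key i).
rewrite !big_split/= -!mulr_sumr sumr_const card_ord -/(dot q q).
rewrite -/(proj2 (grad f x) V).
rewrite [dot q q]/dot -mulr_natl => sm; lra.
Qed.

End Step.
End OneStep.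

(** * Borel sets of matrices *)

Section MatrixBorel.
Context {R : realType} {m n : nat}.

Lemma measurable_continuous_mx (h : 'M[R]_(m, n) -> R) : continuous h ->
  measurable_fun setT (h : borel_mx R m n -> R).
Proof.
move=> hc; apply: (measurability _ (RGenOInfty.measurableE R)).
move=> _ [_ [a ->] <-]; rewrite setTI; apply: sub_sigma_algebra.
by move/continuousP : hc; apply; exact: interval_open.
Qed.

Lemma measurable_entry i j :
  measurable_fun setT (fun M : borel_mx R m n => (M : 'M[R]_(m, n)) i j).
Proof. by apply: measurable_continuous_mx; exact: coord_continuous. Qed.

(** An open set is the countable union of the rational boxes that it contains,
    and the preimage of a box is a finite intersection of preimages of balls
    under the entries. *)
Lemma measurable_mx {d} {T : measurableType d} (X : T -> 'M[R]_(m, n)) :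
  (forall i j, measurable_fun setT (fun w => X w i j)) ->
  measurable_fun setT (X : T -> borel_mx R m n).
Proof.
move=> Xij.
apply: (@measurability _ _ T (borel_mx R m n) setT X (@open 'M[R]_(m, n))
  erefl) => _ [U oU <-]; rewrite setTI.
pose box (c : 'M[rat]_(m, n) * nat) : set 'M[R]_(m, n) :=
  [set M | forall i j, `|ratr (c.1 i j) - M i j| < c.2.+1%:R^-1].
pose F (l : nat) : set T :=
  if @unpickle ('M[rat]_(m, n) * nat)%type l is Some c then
    if `[< box c `<=` U >] then X @^-1` box c else set0
  else set0.
have mbox c : measurable (X @^-1` box c).
  have -> : X @^-1` box c = \bigcap_(ij in [set: 'I_m * 'I_n])
      [set w | `|ratr (c.1 ij.1 ij.2) - X w ij.1 ij.2| < c.2.+1%:R^-1].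
    apply/seteqP; split => w /= h; first by move=> [i j] _; exact: h.
    by move=> i j; exact: (h (i, j)).
  apply: fin_bigcap_measurable; first exact: finite_finset.
  move=> [i j] _ /=.
  have := Xij i j measurableT _ (measurable_ball (ratr (c.1 i j)) c.2.+1%:R^-1).
  by rewrite setTI.
have -> : X @^-1` U = \bigcup_l F l.
  apply/seteqP; split => [w /= Uw|w [l _]]; last first.
    rewrite /F; case: unpickle => // c; case: asboolP => // cU.
    exact: cU.
  have [e e0 eU] : exists2 e, 0 < e & ball (X w) e `<=` U.
    by move: oU; rewrite openE => /(_ _ Uw) /nbhs_ballP[e e0 h]; exists e.
  (* A box that contains [X w] has diameter at most twice its radius. *)
  have [N hN] : exists N : nat, 2 * N.+1%:R^-1 < e.
    exists (Num.truncn (2 / e)).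
    rewrite ltr_pdivrMr// mulrC -ltr_pdivrMr//.
    exact: truncnS_gt.
  have /choice [q hq] : forall ij : 'I_m * 'I_n, exists q : rat,
      `|ratr q - X w ij.1 ij.2| < N.+1%:R^-1.
    move=> [i j] /=; have N0 : 0 < N.+1%:R^-1 :> R by rewrite invr_gt0.
    have [q /itvP qe] : exists q, ratr q \in
        `]X w i j - N.+1%:R^-1, X w i j + N.+1%:R^-1[.
      by apply: rat_in_itvoo; rewrite ltrD2l gtrN.
    by exists q; rewrite ltr_distl !qe.
  pose c : 'M[rat]_(m, n) * nat := (\matrix_(i, j) q (i, j), N).
  exists (pickle c) => //; rewrite /F pickleK.
  have cw : box c (X w) by move=> i j; rewrite /= mxE; exact: (hq (i, j)).
  case: asboolP => // -[] M cM; apply: eU; split => // i j.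
  have h1 := cw i j; have h2 := cM i j; rewrite /= in h1 h2.
  rewrite /ball/=; apply: le_lt_trans hN.
  rewrite -(subrKA (ratr (c.1 i j))) (le_trans (ler_normD _ _))//.
  by rewrite distrC mulr_natl mulr2n lerD// ltW.
apply: bigcupT_measurable => l; rewrite /F; case: unpickle => // c.
by case: asboolP.
Qed.
End MatrixBorel.

(** * Expectations of integrable real random variables *)

Section Expectation.
Context {R : realType} {d} {T : measurableType d} (P : probability T R).
Implicit Types X Y : T -> R.

(** Stated for an abstract measurable type so that it also applies to generated
    sigma-algebras, where the type alias hides the filter instance. *)
Lemma ae_imp (A B : T -> Prop) : {ae P, forall w, A w} ->
  (forall w, A w -> B w) -> {ae P, forall w, B w}.
Proof. by move=> PA AB; apply: filterS PA. Qed.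

Lemma ae_bounded_integrable X (M : R) : measurable_fun setT X ->
  {ae P, forall w, `|X w| <= M} -> P.-integrable setT (EFin \o X).
Proof.
move=> mX XM; apply/integrableP; split; first exact/measurable_EFinP.
apply: (@le_lt_trans _ _ (\int[P]_w (cst `|M|%:E w))%E); last first.
  by rewrite integral_cst//= probability_setT mule1 ltry.
apply: ae_ge0_le_integral => //.
- by do 2 apply: measurableT_comp => //.
- by move=> w _; rewrite lee_fin.
- by apply: filterS XM => w h _; rewrite lee_fin (le_trans h)// ler_norm.
Qed.

Lemma integrable_measurable X : P.-integrable setT (EFin \o X) ->
  measurable_fun setT X.
Proof. by move/measurable_int/measurable_EFinP. Qed.

Lemma ae_eq_Rintegral X Y : measurable_fun setT X -> measurable_fun setT Y ->
  {ae P, forall w, X w = Y w} -> \int[P]_w X w = \int[P]_w Y w.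
Proof.
move=> mX mY XY; rewrite /Rintegral; congr fine.
apply: ae_eq_integral => //; [exact/measurable_EFinP|exact/measurable_EFinP|].
by apply: filterS XY => w -> _.
Qed.

Lemma ae_le_Rintegral X Y : P.-integrable setT (EFin \o X) ->
  P.-integrable setT (EFin \o Y) -> {ae P, forall w, X w <= Y w} ->
  \int[P]_w X w <= \int[P]_w Y w.
Proof.
move=> iX iY XY; rewrite -subr_ge0 -RintegralB//.
have mX := integrable_measurable _ iX; have mY := integrable_measurable _ iY.
rewrite (ae_eq_Rintegral _ (fun w => `|Y w - X w|)).
- by apply: Rintegral_ge0.
- exact: measurable_funB.
- by apply: measurableT_comp => //; exact: measurable_funB.
- by apply: filterS XY => w h; rewrite ger0_norm// subr_ge0.
Qed.

Lemma integrable_Rsum (I : Type) (s : seq I) (F : I -> T -> R) :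
  (forall i, P.-integrable setT (EFin \o F i)) ->
  P.-integrable setT (EFin \o (fun w => \sum_(i <- s) F i w)).
Proof.
move=> iF; have := @integrable_sum _ _ _ P setT measurableT I s xpredT
  (fun i => EFin \o F i) (fun i _ => iF i).
by apply: eq_integrable => // w _ /=; rewrite -sumEFin.
Qed.

Lemma Rintegral_sum (I : Type) (s : seq I) (F : I -> T -> R) :
  (forall i, P.-integrable setT (EFin \o F i)) ->
  \int[P]_w (\sum_(i <- s) F i w) = \sum_(i <- s) \int[P]_w F i w.
Proof.
move=> iF; elim: s => [|i s IH].
  rewrite big_nil (@eq_Rintegral _ _ _ _ _ (cst 0)); last first.
    by move=> w _; rewrite big_nil.
  by rewrite Rintegral_cst//= mul0r.
rewrite big_cons -IH -RintegralD//; last exact: integrable_Rsum.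
by apply: eq_Rintegral => w _; rewrite big_cons.
Qed.

Lemma Rintegral_prob_cst (r : R) : \int[P]_w (cst r w) = r.
Proof. by rewrite Rintegral_cst//= probability_setT mulr1. Qed.

Lemma integrable_cst_prob (r : R) : P.-integrable setT (EFin \o cst r).
Proof. exact: finite_measure_integrable_cst. Qed.

(** Independence says that the joint distribution of [X] and [Y] is the product
    of the marginal ones; then Fubini's theorem applies. *)
Lemma Rintegral_indepM X Y : P.-integrable setT (EFin \o X) ->
  P.-integrable setT (EFin \o Y) ->
  P.-integrable setT (EFin \o (fun w => X w * Y w)) ->
  (forall A B, measurable A -> measurable B ->
    P (X @^-1` A `&` Y @^-1` B) = (P (X @^-1` A) * P (Y @^-1` B))%E) ->
  \int[P]_w (X w * Y w) = (\int[P]_w X w) * (\int[P]_w Y w).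
Proof.
move=> iX iY iXY ind.
have mX := integrable_measurable _ iX; have mY := integrable_measurable _ iY.
pose X' : {RV P >-> R} := HB.pack X (isMeasurableFun.Build _ _ _ _ X mX).
pose Y' : {RV P >-> R} := HB.pack Y (isMeasurableFun.Build _ _ _ _ Y mY).
have mXY : measurable_fun setT (fun w => (X w, Y w)) by exact: measurable_fun_pair.
pose Z : {RV P >-> (R * R)%type} := HB.pack (fun w => (X w, Y w))
  (isMeasurableFun.Build _ _ _ _ (fun w => (X w, Y w)) mXY).
pose m1 := distribution P X'; pose m2 := distribution P Y'.
have prodE A : measurable A -> (m1 \x m2)%E A = distribution P Z A.
  apply: (@product_measure_unique _ _ _ _ _ m1 m2 (distribution P Z)).
  move=> B C mB mC; rewrite -ind//.
pose g (z : R * R) : \bar R := (z.1 * z.2)%:E.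
have mg : measurable_fun setT g.
  by apply/measurable_EFinP/measurable_funM.
have igZ : (distribution P Z).-integrable setT g.
  by apply: integrable_pushforward.
have ig : (m1 \x m2)%E.-integrable setT g.
  apply/integrableP; split => //.
  rewrite (eq_measure_integral (distribution P Z)); last first.
    by move=> A mA _; exact: prodE.
  by case/integrableP : igZ.
have E1 : (\int[m1 \x m2]_z g z = \int[P]_w (X w * Y w)%:E)%E.
  rewrite (eq_measure_integral (distribution P Z)); last first.
    by move=> A mA _; exact: prodE.
  by rewrite integral_distribution.
rewrite -(integral12_prod_meas1 ig) in E1.
have iX1 : m1.-integrable setT EFin by exact: integrable_pushforward.
have iY1 : m2.-integrable setT EFin by exact: integrable_pushforward.
have EX : (\int[m1]_x x%:E = \int[P]_w (X w)%:E)%E.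
  by rewrite integral_distribution.
have EY : (\int[m2]_x x%:E = \int[P]_w (Y w)%:E)%E.
  by rewrite integral_distribution.
rewrite /Rintegral -E1 -EX -EY.
have fY : (\int[m2]_x x%:E)%E \is a fin_num by exact: integrable_fin_num.
have fX : (\int[m1]_x x%:E)%E \is a fin_num by exact: integrable_fin_num.
rewrite -fineM//; congr fine.
under eq_integral => x _.
  rewrite /fubini_F /g/=.
  under eq_integral do rewrite EFinM.
  rewrite integralZl//.
  over.
rewrite -(fineK fY).
by rewrite integralZr//.
Qed.

End Expectation.

(** * Independence of the past *)

Section Past.
Context {R : realType} {d d'} {T : measurableType d} {T' : measurableType d'}
  (P : probability T R) (V : nat -> {RV P >-> T'}).
Hypothesis Vind : mutually_independent P (fun t => V t : T -> T').

(** A pi-system generating the sigma-algebra of [V 0], ..., [V (t - 1)]. *)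
Definition past_cylinders (t : nat) : set (set T) :=
  [set A | exists2 B : nat -> set T', (forall s, measurable (B s)) &
     A = \bigcap_(s in [set` iota 0 t]) (V s @^-1` B s)].

Lemma past_cylinders_measurable t : past_cylinders t `<=` measurable.
Proof.
move=> _ [B mB ->]; apply: fin_bigcap_measurable; first exact: finite_seq.
by move=> s _; rewrite -[X in measurable X]setTI; exact: measurable_funPT.
Qed.

Lemma past_cylindersI t : setI_closed (past_cylinders t).
Proof.
move=> _ _ [B mB ->] [C mC ->]; exists (fun s => B s `&` C s).
  by move=> s; exact: measurableI.
rewrite -bigcapI; apply: eq_bigcapr => s _.
by rewrite preimage_setI.
Qed.

Lemma measurable_past t s : (s < t)%N ->
  measurable_fun setT (V s : g_sigma_algebraType (past_cylinders t) -> T').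
Proof.
move=> st _ A mA; rewrite setTI; apply: sub_sigma_algebra.
exists (fun r => if r == s then A else setT) => [r|]; first by case: ifP.
apply/seteqP; split => w /=.
  by move=> Aw r _ /=; case: eqP => // ->.
by move=> /(_ s); rewrite /= mem_iota add0n st eqxx; exact.
Qed.

(** For a fixed [B], both sides are finite measures in [A].  They agree on the
    cylinders by mutual independence, hence on the generated sigma-algebra. *)
Lemma past_independent t (A : set T) (B : set T') : <<s past_cylinders t >> A ->
  measurable B -> P (A `&` V t @^-1` B) = (P A * P (V t @^-1` B))%E.
Proof.
move=> sA mB.
have mVB : measurable (V t @^-1` B).
  by rewrite -[X in measurable X]setTI; exact: measurable_funPT.
have PB0 : 0 <= fine (P (V t @^-1` B)) by rewrite fine_ge0.
have PBE : (NngNum PB0)%:num%:E = P (V t @^-1` B) by rewrite fineK// fin_num_measure.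
have mscaleE C : mscale (NngNum PB0) P C = (P C * P (V t @^-1` B))%E.
  by rewrite /mscale PBE muleC.
rewrite -mscaleE.
apply: (@g_sigma_algebra_measure_unique _ R T (past_cylinders t)
  (@past_cylinders_measurable t) (fun=> setT) _ _
  (mrestr P mVB) (mscale (NngNum PB0) P) (@past_cylindersI t)) => //.
- move=> _; exists (fun=> setT) => //.
  by apply/seteqP; split => w /=.
- by rewrite bigcup_const.
- move=> _ [C mC ->]; apply: etrans (esym (mscaleE _)); rewrite /= /mrestr.
  pose D s := if s == t then B else C s.
  have mD s : measurable (D s) by rewrite /D; case: ifP.
  have := Vind (iota 0 t.+1) D (iota_uniq _ _) mD.
  have := Vind (iota 0 t) C (iota_uniq _ _) mC.
  rewrite -[t.+1]addn1 iotaD add0n/= cats1.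
  have -> : (\bigcap_(s in [set` rcons (iota 0 t) t]) (V s @^-1` D s) =
    \bigcap_(s in [set` iota 0 t]) (V s @^-1` C s) `&` V t @^-1` B)%classic.
    apply/seteqP; split => w /=.
      move=> h; split; last first.
        by have := h t; rewrite /= mem_rcons mem_head /D eqxx; exact.
      move=> s /= st; have := h s; rewrite /= mem_rcons inE st orbT /D.
      move: st; rewrite mem_iota add0n => /andP[_ st].
      by rewrite (ltn_eqF st); exact.
    move=> [h hB] s /=; rewrite mem_rcons inE /D; case: eqP => [->//|_ /=].
    exact: h.
  move=> -> ->; rewrite big_rcons/=; congr (_ * _)%E; last by rewrite /D eqxx.
  rewrite [LHS]big_seq [RHS]big_seq.
  apply: eq_bigr => s; rewrite mem_iota add0n => /andP[_ st].
  by rewrite /D (ltn_eqF st).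
- by move=> _; rewrite /mrestr (le_lt_trans (probability_le1 _ _)) ?ltry// setTI.
Qed.

End Past.

(** * Second moments of the uniform distribution on the Stiefel manifold *)

Section Stiefel.
Context {R : realType} {n k : nat}.
Variable mu : probability (borel_mx R n k) R.
Hypothesis mu_unif : uniform_stiefel mu.

Let gram i j (V : borel_mx R n k) : R := ((V : 'M[R]_(n, k)) *m V^T) i j.

Lemma measurable_gram i j : measurable_fun setT (gram i j).
Proof.
rewrite (_ : gram i j = fun V : borel_mx R n k =>
  \sum_l (V : 'M[R]_(n, k)) i l * (V : 'M[R]_(n, k)) j l).
  apply: measurable_sum => l.
  by apply: measurable_funM; exact: measurable_entry.
by apply/funext => V; rewrite /gram mxE; apply: eq_bigr => l _; rewrite mxE.
Qed.

#[local] Hint Resolve measurable_gram : core.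

Lemma measurable_stiefel : measurable (@stiefel R n k : set (borel_mx R n k)).
Proof.
have -> : (@stiefel R n k : set (borel_mx R n k)) =
    \bigcap_(ij in [set: 'I_k * 'I_k]) [set V : borel_mx R n k |
       ((V : 'M[R]_(n, k))^T *m V) ij.1 ij.2 = (1%:M : 'M[R]_k) ij.1 ij.2].
  apply/seteqP; split => V /=.
    by move=> hV ij _; exact: (congr1 (fun M : 'M[R]_k => M ij.1 ij.2) hV).
  by move=> h; apply/matrixP => i j; exact: (h (i, j)).
apply: fin_bigcap_measurable; first exact: finite_finset.
move=> [i j] _ /=.
have m : measurable_fun setT
    (fun V : borel_mx R n k => ((V : 'M[R]_(n, k))^T *m V) i j).
  under eq_fun do rewrite mxE.
  apply: measurable_sum => l; apply: measurable_funM => //.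
    by under eq_fun do rewrite mxE; exact: measurable_entry.
  exact: measurable_entry.
have := m measurableT _ (measurable_set1 ((1%:M : 'M[R]_k) i j)).
by rewrite setTI.
Qed.

Lemma ae_stiefel : {ae mu, forall V, stiefel V}.
Proof.
exists (~` (@stiefel R n k)); split => //.
  by apply: measurableC; exact: measurable_stiefel.
rewrite probability_setC; last exact: measurable_stiefel.
by case: mu_unif => -> _; rewrite subee.
Qed.

Lemma stiefel_entry_le1 (V : 'M[R]_(n, k)) i j : stiefel V -> `|V i j| <= 1.
Proof.
move=> hV; rewrite -(enorm_col_stiefel V j hV).
by have := le_entry_enorm (col j V) i; rewrite mxE.
Qed.

Lemma stiefel_gram_le (V : 'M[R]_(n, k)) i j : stiefel V ->
  `|(V *m V^T) i j| <= k%:R.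
Proof.
move=> hV; rewrite mxE (le_trans (ler_norm_sum _ _ _))//.
apply: le_trans (_ : \sum_(l < k) 1 <= _); last by rewrite sumr_const card_ord.
apply: ler_sum => l _; rewrite normrM mxE -[leRHS]mulr1.
by apply: ler_pM => //; exact: stiefel_entry_le1.
Qed.

Let integrable_gram i j : mu.-integrable setT (EFin \o gram i j).
Proof.
apply: (ae_bounded_integrable _ _ k%:R); first exact: measurable_gram.
by apply: ae_imp ae_stiefel _ => V hV; exact: stiefel_gram_le.
Qed.

Let measurable_mulmx (Q : 'M[R]_n) : measurable_fun setT
  (mulmx Q : borel_mx R n k -> borel_mx R n k).
Proof.
apply: measurable_mx => i j.
under eq_fun do rewrite mxE.
by apply: measurable_sum => l; apply: measurable_funM => //; exact: measurable_entry.
Qed.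

(** Integration against the image of [mu] under an orthogonal [Q] is integration
    against [mu] itself. *)
Lemma Rintegral_rotation (Q : 'M[R]_n) i j : Q^T *m Q = 1%:M ->
  \int[mu]_V gram i j (mulmx Q V) = \int[mu]_V gram i j V.
Proof.
move=> QQ; rewrite /Rintegral; congr fine.
have -> : (\int[mu]_V (gram i j V)%:E =
  \int[pushforward mu (mulmx Q : borel_mx R n k -> borel_mx R n k)]_V
     (gram i j V)%:E)%E.
  apply: eq_measure_integral => A mA _.
  exact: (esym (mu_unif.2 Q QQ A mA)).
rewrite integral_pushforward//; first exact/measurable_EFinP.
rewrite preimage_setT.
suff : mu.-integrable setT (EFin \o (fun V => gram i j (mulmx Q V))) by [].
apply: (ae_bounded_integrable mu (fun V => gram i j (mulmx Q V)) k%:R).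
  exact: (measurableT_comp (measurable_gram i j) (measurable_mulmx Q)).
apply: ae_imp ae_stiefel _ => V hV; apply: stiefel_gram_le.
by rewrite /stiefel/= trmx_mul -mulmxA (mulmxA Q^T) QQ mul1mx.
Qed.

Let gram_mulmx (Q : 'M[R]_n) (V : 'M[R]_(n, k)) :
  (Q *m V) *m (Q *m V)^T = Q *m (V *m V^T) *m Q^T.
Proof. by rewrite trmx_mul !mulmxA. Qed.

(** Reflecting the [i]-th coordinate changes the sign of the entry [(i, j)] and
    preserves the distribution. *)
Lemma stiefel_gram_offdiag i j : i != j -> \int[mu]_V gram i j V = 0.
Proof.
move=> ij.
pose Q : 'M[R]_n := 1%:M - 2 *: delta_mx i i.
have QT : Q^T = Q by rewrite /Q linearB/= linearZ/= trmx1 trmx_delta.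
have QQ : Q^T *m Q = 1%:M.
  rewrite QT /Q mulmxBl mul1mx mulmxBr mulmx1 -scalemxAl -scalemxAr.
  rewrite mul_delta_mx scalerA -scalerBl -addrA -opprD -scalerDl.
  by rewrite (_ : 2 + (2 - 2 * 2) = 0) ?scale0r ?subr0//; ring.
have Qrow a : Q i a = - (i == a)%:R.
  by rewrite !mxE eqxx /= [a == i]eq_sym; case: (i == a); rewrite /=; ring.
have Qcol b : Q b j = (b == j)%:R.
  by rewrite !mxE [j == i]eq_sym (negbTE ij) andbF mulr0 subr0.
have := Rintegral_rotation Q i j QQ.
have -> : \int[mu]_V gram i j (mulmx Q V) = - \int[mu]_V gram i j V.
  rewrite -mulN1r -RintegralZl//; apply: eq_Rintegral => V _.
  rewrite /gram gram_mulmx QT mulN1r mxE (bigD1 j)//= big1; last first.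
    by move=> b /negbTE bj; rewrite Qcol bj mulr0.
  rewrite Qcol eqxx mulr1 addr0 mxE (bigD1 i)//= big1; last first.
    by move=> a; rewrite eq_sym Qrow => /negbTE ->; rewrite oppr0 mul0r.
  by rewrite Qrow eqxx mulN1r addr0.
by lra.
Qed.

(** Exchanging two coordinates preserves the distribution. *)
Lemma stiefel_gram_diag i j : \int[mu]_V gram i i V = \int[mu]_V gram j j V.
Proof.
rewrite -(Rintegral_rotation (perm_mx (tperm i j)) i i); last first.
  by rewrite tr_perm_mx -perm_mxM mulVg perm_mx1.
apply: eq_Rintegral => V _; rewrite /gram gram_mulmx tr_perm_mx.
by rewrite -row_permE -col_permE 2!mxE tpermL.
Qed.

(** The [n] diagonal entries have the same mean, and their sum is the trace of
    [V^T V = I], that is [k]. *)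
Lemma Rintegral_gram i j :
  \int[mu]_V gram i j V = (i == j)%:R * (k%:R / n%:R).
Proof.
have [<-|ij] := eqVneq i j; last by rewrite mul0r stiefel_gram_offdiag.
have n0 : n%:R != 0 :> R by rewrite pnatr_eq0; case: n i => [[]|].
rewrite mul1r; apply: (mulIf n0); rewrite divfK//.
have : \int[mu]_V (\sum_l gram l l V) = k%:R.
  rewrite -[RHS](Rintegral_prob_cst mu); apply: ae_eq_Rintegral => //.
    by apply: measurable_sum.
  apply: ae_imp ae_stiefel _ => V hV.
  have -> : \sum_l gram l l V = \tr ((V : 'M[R]_(n, k)) *m V^T) by [].
  by rewrite mxtrace_mulC hV mxtrace1.
rewrite Rintegral_sum// (eq_bigr (fun=> \int[mu]_V gram i i V)); last first.
  by move=> l _; exact: stiefel_gram_diag.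
by rewrite sumr_const card_ord mulr_natr.
Qed.

End Stiefel.

(** * Measurability of the iterates *)

Section MeasurableIterates.
Context {R : realType} {n k : nat} {d} {T : measurableType d}.

Lemma measurable_mx_entry {m p : nat} (X : T -> 'M[R]_(m, p)) i j :
  measurable_fun setT (X : T -> borel_mx R m p) ->
  measurable_fun setT (fun w => X w i j).
Proof. by move=> mX; exact: (measurableT_comp (measurable_entry i j) mX). Qed.

(** The measurable space [T] is arbitrary so that the lemma applies both to the
    ambient probability space and to the sigma-algebra of the past, for which
    only the directions before time [t] are measurable. *)
Lemma measurable_szgd (f : 'cV[R]_n -> R) (eta : nat -> R) (delta0 : R)
    (x0 : 'cV[R]_n) (V : nat -> T -> 'M[R]_(n, k)) (t : nat) :
  continuous f ->
  (forall s, (s < t)%N -> measurable_fun setT (V s : T -> borel_mx R n k)) ->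
  measurable_fun setT
    (fun w => szgd f eta delta0 x0 (fun s => V s w) t : borel_mx R n 1).
Proof.
move=> fc; elim: t => [|t IH] mV; first exact: measurable_cst.
have {}IH := IH (fun s st => mV s (ltnW st)).
have mVt := mV t (ltnSn t).
have mfx (b : R) l : measurable_fun setT (fun w =>
    f (szgd f eta delta0 x0 (fun s => V s w) t + b *: col l (V t w))).
  apply: (measurableT_comp (measurable_continuous_mx f fc)).
  apply: measurable_mx => i j; under eq_fun do rewrite !mxE.
  apply: measurable_funD; first exact: measurable_mx_entry IH.
  by apply: measurable_funM => //; exact: measurable_mx_entry mVt.
apply: measurable_mx => i j /=; under eq_fun do rewrite !mxE summxE.
apply: measurable_funB; first exact: measurable_mx_entry IH.
apply: measurable_funM => //; apply: measurable_funM => //.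
apply: measurable_sum => l; under eq_fun do rewrite !mxE.
apply: measurable_funM; last exact: measurable_mx_entry mVt.
apply: measurable_funB; first exact: mfx.
under eq_fun do rewrite -scaleNr.
exact: mfx.
Qed.

Lemma measurable_enorm (X : T -> 'cV[R]_n) :
  measurable_fun setT (X : T -> borel_mx R n 1) ->
  measurable_fun setT (fun w => enorm (X w)).
Proof.
move=> mX; rewrite /enorm; apply: (measurableT_comp (f := @Num.sqrt R)).
  by apply: continuous_measurable_fun; exact: sqrt_continuous.
apply: measurable_sum => i; apply: measurable_funX.
exact: measurable_mx_entry mX.
Qed.

Lemma measurable_mxB {m p : nat} (X Y : T -> 'M[R]_(m, p)) :
  measurable_fun setT (X : T -> borel_mx R m p) ->
  measurable_fun setT (Y : T -> borel_mx R m p) ->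
  measurable_fun setT ((fun w => X w - Y w) : T -> borel_mx R m p).
Proof.
move=> mX mY; apply: measurable_mx => i j; under eq_fun do rewrite !mxE.
by apply: measurable_funB; exact: measurable_mx_entry.
Qed.

End MeasurableIterates.

(** * The energy of the random iterates *)

Lemma continuous_enorm {R : realType} {n : nat} : continuous (@enorm R n).
Proof.
suff h s : continuous (fun y : 'cV[R]_n => \sum_(i <- s) y i ord0 ^+ 2).
  by move=> x; apply: continuous_comp; [exact: h|exact: sqrt_continuous].
elim: s => [|i s IH] x.
  rewrite (_ : (fun y => _) = cst 0); first exact: cst_continuous.
  by apply/funext => y; rewrite big_nil.
rewrite (_ : (fun y => _) = (fun y : 'cV[R]_n => y i ord0 ^+ 2) +
    (fun y : 'cV[R]_n => \sum_(i <- s) y i ord0 ^+ 2)); last first.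
  by apply/funext => y; rewrite big_cons.
apply: continuousD; last exact: IH.
apply: (continuous_comp (g := fun z : R => z ^+ 2)); last exact: exprn_continuous.
exact: coord_continuous.
Qed.

Section Process.
Context {R : realType} {n k : nat} {d} {Omega : measurableType d}
  (P : probability Omega R).
Variables (f : 'cV[R]_n -> R) (L : R) (V : nat -> {RV P >-> borel_mx R n k})
  (x0 : 'cV[R]_n) (delta0 : R) (eta : nat -> R) (eta_lo eta_hi : R)
  (xstar : 'cV[R]_n) (mu : R).
Let X t w : 'cV[R]_n := szgd f eta delta0 x0 (fun s => V s w) t.
Let g t w : 'cV[R]_n := grad f (X t w).
Let delta t : R := szgd_delta delta0 t.
Let kappa : R := n%:R / k%:R.

Hypothesis hk : (1 <= k <= n)%N.
Hypothesis Vunif : forall t, uniform_stiefel (distribution P (V t)).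
Hypothesis Vind : mutually_independent P (fun t => V t : Omega -> borel_mx R n k).
Hypothesis delta0_01 : 0 < delta0 <= 1.
Hypotheses (L0 : 0 < L) (fL : smooth L f).
Hypothesis xstar_crit : grad f xstar = 0.
Hypothesis mu0 : 0 < mu.
Hypothesis X_ball : {ae P, forall w, forall t, enorm (X t w - xstar) <= mu}.
Hypothesis elo0 : 0 < eta_lo.
Hypothesis eta_bnd : forall t, eta_lo <= eta t <= eta_hi.
Hypothesis eta_small : L * kappa * eta_hi < 2.

Let k_gt0 : (0 < k)%N. Proof. by case/andP: hk. Qed.
Let n_gt0 : (0 < n)%N. Proof. by have /andP[k1 kn] := hk; exact: leq_trans kn. Qed.
Let kappa0 : 0 < kappa. Proof. by rewrite divr_gt0 ?ltr0n. Qed.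

Let fc : continuous f.
Proof. by have [df _ _] := fL; move=> y; exact: differentiable_continuous. Qed.

Let delta_gt0 t : 0 < delta t.
Proof.
elim: t => [|t IH]; first by case/andP: delta0_01.
by rewrite /delta /szgd_delta/= divr_gt0.
Qed.

Let delta_le1 t : delta t <= 1.
Proof.
elim: t => [|t IH]; first by case/andP: delta0_01.
have := delta_gt0 t; have : delta t.+1 = delta t / 2 by [].
by move: IH; lra.
Qed.

Lemma ae_stiefel_V t : {ae P, forall w, stiefel (V t w : 'M[R]_(n, k))}.
Proof.
pose S : set (borel_mx R n k) := @stiefel R n k.
have mVS : measurable (V t @^-1` S).
  have := measurable_funPT (V t) measurableT S measurable_stiefel.
  by rewrite setTI.
exists (~` (V t @^-1` S)); split => //; first exact: measurableC.
rewrite probability_setC//.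
have -> : P (V t @^-1` S) = 1%E by have [+ _] := Vunif t.
by rewrite subee.
Qed.

Let mV t : measurable_fun setT (V t : Omega -> borel_mx R n k).
Proof. exact: measurable_funPT. Qed.

Lemma measurable_iterate t :
  measurable_fun setT (X t : Omega -> borel_mx R n 1).
Proof. by apply: measurable_szgd => // s _; exact: mV. Qed.

Let mfX t : measurable_fun setT (fun w => f (X t w)).
Proof.
exact: (measurableT_comp (measurable_continuous_mx f fc) (measurable_iterate t)).
Qed.

Let grad_entry_continuous i : continuous (fun y => grad f y i ord0).
Proof.
have [_ gc _] := fL => y.
exact: (continuous_comp (gc y) (coord_continuous (i := i) (j := ord0) (x := _))).
Qed.

Let mg t i : measurable_fun setT (fun w => g t w i ord0).
Proof.
exact: (measurableT_comp
  (measurable_continuous_mx _ (grad_entry_continuous i)) (measurable_iterate t)).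
Qed.

Let grad_bound y : enorm (y - xstar) <= mu -> enorm (grad f y) <= L * mu.
Proof.
move=> h; have [_ _ lip] := fL.
have := lip y xstar; rewrite xstar_crit subr0 => /le_trans; apply.
by rewrite ler_pM2l.
Qed.

(** Second-order bound around a critical point; it makes every random variable
    below bounded. *)
Lemma smooth_gap_le y : enorm (y - xstar) <= mu ->
  `|f y - f xstar| <= L / 2 * mu ^+ 2.
Proof.
move=> h; have := smooth_taylor f L fL xstar (y - xstar).
rewrite xstar_crit subrKC.
rewrite (_ : dot 0 _ = 0) ?subr0; last first.
  by apply: big1 => i _; rewrite mxE mul0r.
move=> /le_trans; apply; rewrite ler_pM2l ?divr_gt0//.
by rewrite ler_sqr ?nnegrE ?enorm_ge0// ltW.
Qed.

Let mgg t : measurable_fun setT (fun w => dot (g t w) (g t w)).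
Proof. by apply: measurable_sum => i; exact: measurable_funM. Qed.

Let igg t : P.-integrable setT (EFin \o (fun w => dot (g t w) (g t w))).
Proof.
apply: (ae_bounded_integrable P _ ((L * mu) ^+ 2)) => //.
apply: ae_imp X_ball _ => w /(_ t) h.
rewrite ger0_norm ?dot_ge0// -sqr_enorm ler_sqr ?nnegrE ?enorm_ge0//.
  exact: grad_bound.
by rewrite mulr_ge0// ltW.
Qed.

Let ifX t : P.-integrable setT (EFin \o (fun w => f (X t w))).
Proof.
apply: (ae_bounded_integrable P _ (L / 2 * mu ^+ 2 + `|f xstar|)) => //.
apply: ae_imp X_ball _ => w /(_ t) /smooth_gap_le h.
rewrite -[f (X t w)](subrK (f xstar)) (le_trans (ler_normD _ _))//.
by rewrite lerD2r.
Qed.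

Let ggij t i j w : R := g t w i ord0 * g t w j ord0.
Let gram t i j w : R := ((V t w : 'M[R]_(n, k)) *m (V t w : 'M[R]_(n, k))^T) i j.

Let mggij t i j : measurable_fun setT (ggij t i j).
Proof. exact: measurable_funM. Qed.

Let mgramV t i j : measurable_fun setT (gram t i j).
Proof. exact: (measurableT_comp (measurable_gram i j) (mV t)). Qed.

Let ggij_bound t i j w : enorm (X t w - xstar) <= mu ->
  `|ggij t i j w| <= (L * mu) ^+ 2.
Proof.
move=> /grad_bound h; rewrite /ggij normrM expr2; apply: ler_pM => //.
  exact: le_trans (le_entry_enorm _ _) h.
exact: le_trans (le_entry_enorm _ _) h.
Qed.

Let iggij t i j : P.-integrable setT (EFin \o ggij t i j).
Proof.
apply: (ae_bounded_integrable P _ ((L * mu) ^+ 2)) => //.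
by apply: ae_imp X_ball _ => w /(_ t); exact: ggij_bound.
Qed.

Let igram t i j : P.-integrable setT (EFin \o gram t i j).
Proof.
apply: (ae_bounded_integrable P _ k%:R) => //.
by apply: ae_imp (ae_stiefel_V t) _ => w h; exact: stiefel_gram_le.
Qed.

Let iprod t i j :
  P.-integrable setT (EFin \o (fun w => ggij t i j w * gram t i j w)).
Proof.
apply: (ae_bounded_integrable P _ ((L * mu) ^+ 2 * k%:R)).
  exact: measurable_funM.
apply: filterS2 X_ball (ae_stiefel_V t) => w /(_ t) h1 h2.
by rewrite normrM; apply: ler_pM => //; [exact: ggij_bound|exact: stiefel_gram_le].
Qed.

Let E_gram t i j : \int[P]_w gram t i j w = (i == j)%:R * (k%:R / n%:R).
Proof.
rewrite -(Rintegral_gram _ (Vunif t)) /Rintegral; congr fine.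
rewrite integral_distribution//.
  by apply/measurable_EFinP; exact: measurable_gram.
exact: igram.
Qed.

(** [x_t] is measurable for the past, so the gradient entries are independent of
    [V_t]. *)
Let E_prod t i j : \int[P]_w (ggij t i j w * gram t i j w) =
  (\int[P]_w ggij t i j w) * (\int[P]_w gram t i j w).
Proof.
apply: Rintegral_indepM => // A B mA mB.
pose B' : set (borel_mx R n k) :=
  (fun M : borel_mx R n k => ((M : 'M[R]_(n, k)) *m M^T) i j) @^-1` B.
have mB' : measurable B'.
  by rewrite -[X in measurable X]setTI; exact: measurable_gram.
have -> : gram t i j @^-1` B = V t @^-1` B' by [].
apply: past_independent => //.
have mX : measurable_fun setT (X t : g_sigma_algebraType
    (past_cylinders P V t) -> borel_mx R n 1).
  by apply: measurable_szgd => // s st; exact: measurable_past.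
have mgp l : measurable_fun setT
    ((fun w => g t w l ord0) : g_sigma_algebraType (past_cylinders P V t) -> R).
  exact: (measurableT_comp
    (measurable_continuous_mx _ (grad_entry_continuous l)) mX).
have := measurable_funM (mgp i) (mgp j) measurableT mA.
by rewrite setTI.
Qed.

(** By independence, each term of [proj2E] has as mean the product of the mean of
    two gradient entries and of a mean entry of [V_t V_t^T], and the latter
    matrix is on average [k / n] times the identity. *)
Lemma E_proj2 t : P.-integrable setT (EFin \o (fun w => proj2 (g t w) (V t w))) /\
  \int[P]_w proj2 (g t w) (V t w) = k%:R / n%:R * \int[P]_w dot (g t w) (g t w).
Proof.
have E1 : (fun w => proj2 (g t w) (V t w)) =
    (fun w => \sum_i \sum_j ggij t i j w * gram t i j w).
  by apply/funext => w; rewrite proj2E.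
rewrite E1; split.
  by apply: integrable_Rsum => i; exact: integrable_Rsum.
rewrite Rintegral_sum; last by move=> i; exact: integrable_Rsum.
rewrite /dot Rintegral_sum; last by move=> i; exact: iggij.
rewrite mulr_sumr; apply: eq_bigr => i _.
rewrite Rintegral_sum//.
rewrite (bigD1 i)//= big1 ?addr0; last first.
  by move=> j ij; rewrite E_prod E_gram eq_sym (negbTE ij) mul0r mulr0.
by rewrite E_prod E_gram eqxx mul1r mulrC.
Qed.


(* [c] is the least descent coefficient over the allowed step sizes, [A] the
   finite-difference error of [zo_descent] and [D] the constant of
   [enorm_zo_grad_le] times the largest step. *)
Let c : R := eta_lo * (1 - L * kappa * eta_hi / 2).
Let A : R := kappa * (eta_hi ^+ 2 / (2 * c) + eta_hi) * k%:R * (L ^+ 2 / 4).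
Let D : R := eta_hi * (kappa * Num.sqrt (2 + k%:R * L ^+ 2)).
Let gg t w : R := dot (g t w) (g t w).
(* The term [delta t ^+ 2] keeps [m] positive and dominates the
   finite-difference errors. *)
Let m t : R := \int[P]_w gg t w + delta t ^+ 2.

Let ehi0 : 0 < eta_hi.
Proof.
by have /andP[h1 h2] := eta_bnd 0%N; rewrite (lt_le_trans elo0)// (le_trans h1).
Qed.

Let c0 : 0 < c.
Proof. by rewrite mulr_gt0//; move: eta_small; lra. Qed.

Let A0 : 0 < A.
Proof.
rewrite /A; apply: mulr_gt0; last by rewrite divr_gt0// exprn_gt0.
apply: mulr_gt0; last by rewrite ltr0n.
apply: mulr_gt0 => //; apply: addr_gt0 => //.
by rewrite divr_gt0 ?exprn_gt0// mulr_gt0.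
Qed.

Let iproj t := (E_proj2 t).1.

Lemma E_descent t : \int[P]_w f (X t.+1 w) <=
  \int[P]_w f (X t w) - c / 2 * (\int[P]_w gg t w) + A * delta t ^+ 2.
Proof.
pose Y1 w := kappa * (c / 2) * proj2 (g t w) (V t w).
have iY1 : P.-integrable setT (EFin \o Y1).
  have := integrableZl measurableT (kappa * (c / 2)) (iproj t).
  by apply: eq_integrable => // w _; rewrite /= EFinM.
have iY2 : P.-integrable setT (EFin \o (fun w => f (X t w) - Y1 w)).
  exact: (integrableB measurableT (ifX t) iY1).
have iY : P.-integrable setT
    (EFin \o (fun w => f (X t w) - Y1 w + cst (A * delta t ^+ 2) w)).
  exact: (integrableD measurableT iY2 (integrable_cst_prob P _)).
have -> : \int[P]_w f (X t w) - c / 2 * (\int[P]_w gg t w) + A * delta t ^+ 2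
    = \int[P]_w (f (X t w) - Y1 w + cst (A * delta t ^+ 2) w).
  rewrite RintegralD//; last exact: integrable_cst_prob.
  rewrite Rintegral_prob_cst RintegralB//.
  rewrite RintegralZl//.
  rewrite (E_proj2 t).2 /kappa; congr (_ - _ + _).
  by rewrite -/(gg t) /gg; field; rewrite !pnatr_eq0 -!lt0n n_gt0.
apply: ae_le_Rintegral => //.
apply: ae_imp (ae_stiefel_V t) _ => w hV.
have := zo_descent f L L0 fL k_gt0 n_gt0 (X t w) (V t w) (delta t)
  (delta_gt0 t) hV (eta t) eta_lo eta_hi c elo0 (eta_bnd t) eta_small erefl.
by [].
Qed.

Lemma integrable_dist t s :
  P.-integrable setT (EFin \o (fun w => enorm (X t w - X s w))).
Proof.
apply: (ae_bounded_integrable P _ (mu + mu)).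
  by apply: measurable_enorm; apply: measurable_mxB; exact: measurable_iterate.
apply: ae_imp X_ball _ => w h; rewrite ger0_norm ?enorm_ge0//.
rewrite -(subrKA xstar) (le_trans (ler_enormD _ _))// lerD//.
by rewrite enormBC.
Qed.

Let gg_ge0 t : 0 <= \int[P]_w gg t w.
Proof. by apply: Rintegral_ge0 => w _; exact: dot_ge0. Qed.

Let m_gt0 t : 0 < m t.
Proof. by rewrite ltr_wpDl// exprn_gt0. Qed.

(** The mean of [sqrt u] is at most the square root of the mean of [u]; this is
    obtained from [2 s sqrt u <= u + s^2] with [s] the square root of [m t]. *)
Lemma E_displacement t :
  \int[P]_w enorm (X t.+1 w - X t w) <= D * Num.sqrt (m t).
Proof.
set s := Num.sqrt (m t).
have s0 : 0 < s by rewrite sqrtr_gt0.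
have D0 : 0 <= D by rewrite !mulr_ge0 ?sqrtr_ge0// ltW.
pose r : R := D / (2 * s).
have r0 : 0 <= r by rewrite divr_ge0// mulr_ge0// ltW.
have iY1 : P.-integrable setT (EFin \o (fun w => r * proj2 (g t w) (V t w))).
  have := integrableZl measurableT r (iproj t).
  by apply: eq_integrable => // w _; rewrite /= EFinM.
have iY : P.-integrable setT (EFin \o
    (fun w => r * proj2 (g t w) (V t w) + cst (r * (delta t ^+ 2 + s ^+ 2)) w)).
  exact: (integrableD measurableT iY1 (integrable_cst_prob P _)).
apply: le_trans (_ : \int[P]_w (r * proj2 (g t w) (V t w) +
    cst (r * (delta t ^+ 2 + s ^+ 2)) w) <= _).
  apply: ae_le_Rintegral => //; first exact: integrable_dist.
  apply: ae_imp (ae_stiefel_V t) _ => w hV.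
  have := enorm_zo_grad_le f L L0 fL k_gt0 n_gt0 (X t w) (V t w) (delta t)
    (delta_gt0 t) hV.
  rewrite -/(g t w) -/kappa => h.
  have -> : X t.+1 w - X t w = - (eta t *: zo_grad f (delta t) (V t w) (X t w)).
    by rewrite {1}/X/= -/(X t w) addrAC subrr add0r.
  have /andP[et1 et2] := eta_bnd t.
  have et0 : 0 < eta t by exact: lt_le_trans et1.
  rewrite enormN enormZ gtr0_norm//.
  move: h; set u := proj2 _ _ + _; set z := enorm _ => h.
  have u0 : 0 <= u by rewrite addr_ge0 ?proj2_ge0 ?sqr_ge0.
  apply: le_trans (_ : D * Num.sqrt u <= _).
    rewrite /D -mulrA; apply: ler_pM => //; [exact: ltW|exact: enorm_ge0].
  have -> : r * proj2 (g t w) (V t w) + cst (r * (delta t ^+ 2 + s ^+ 2)) w =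
      D * ((u + s ^+ 2) / (2 * s)).
    by rewrite /r /u /cst; field; rewrite gt_eqF.
  rewrite ler_wpM2l// ler_pdivlMr ?mulr_gt0// -{2}(sqr_sqrtr u0).
  have := sqr_ge0 (Num.sqrt u - s); rewrite sqrrB mulr2n; lra.
rewrite RintegralD//; last exact: integrable_cst_prob.
rewrite Rintegral_prob_cst RintegralZl//.
rewrite (E_proj2 t).2 -mulrDr.
apply: le_trans (_ : r * (s ^+ 2 + s ^+ 2) <= _); last first.
  by rewrite le_eqVlt; apply/orP; left; apply/eqP; rewrite /r; field; rewrite gt_eqF.
rewrite ler_wpM2l// addrA lerD2r sqr_sqrtr ?(ltW (m_gt0 t))// lerD2r.
rewrite -[leRHS]mul1r; apply: ler_wpM2r; first exact: gg_ge0.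
rewrite ler_pdivrMr ?ltr0n// mul1r ler_nat.
by case/andP: hk.
Qed.


Lemma E_dist_le t T : (t <= T)%N ->
  \int[P]_w enorm (X t w - X T w) <= D * \sum_(t <= s < T) Num.sqrt (m s).
Proof.
move=> /subnK <-; elim: (T - t)%N => [|j IH].
  rewrite add0n big_geq// mulr0 (@eq_Rintegral _ _ _ _ _ (cst 0)).
    by rewrite Rintegral_prob_cst.
  by move=> w _; rewrite subrr /enorm big1 ?sqrtr0// => i _; rewrite mxE expr0n.
rewrite addSn big_nat_recr ?leq_addl//= mulrDr.
apply: le_trans (lerD IH (E_displacement (j + t))).
rewrite -RintegralD//; [|exact: integrable_dist|exact: integrable_dist].
apply: ae_le_Rintegral; first exact: integrable_dist.
  exact: (integrableD measurableT (integrable_dist _ _) (integrable_dist _ _)).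
apply: aeW => w; rewrite -(subrKA (X (j + t)%N w)) (le_trans (ler_enormD _ _))//.
by rewrite lerD2l enormBC.
Qed.

(** A Lojasiewicz inequality on the ball, solved for the gap of [f]. *)
Variables (C1 r : R).
Hypotheses (C1_gt0 : 0 < C1) (r01 : 0 < r <= 1).
Hypothesis grad_dominates : forall y, enorm (y - xstar) <= mu ->
  `|f y - f xstar| <= C1 * dot (grad f y) (grad f y) `^ r.

(* The factor 4/3 is the inverse of [1 - 1/4], because the squared radius is
   divided by four at each step: [a] is such that the decrease of
   [a * delta t ^+ 2] pays for the error [A] and for the term [c / 2] that comes
   with [delta t ^+ 2] in [m t]. *)
Let a : R := 4 / 3 * (A + c / 2).
Let Z t : R := \int[P]_w f (X t w) - f xstar + a * delta t ^+ 2.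

Let a0 : 0 < a.
Proof. by rewrite mulr_gt0// addr_gt0 ?divr_gt0. Qed.

Let Z_decr t : Z t.+1 <= Z t - c / 2 * m t.
Proof.
have := E_descent t; rewrite /Z /m.
have -> : delta t.+1 = delta t / 2 by [].
have -> : a * (delta t / 2) ^+ 2 = a * delta t ^+ 2 - (A + c / 2) * delta t ^+ 2.
  by rewrite /a; field.
lra.
Qed.

Let idiff t : P.-integrable setT (EFin \o (fun w => f (X t w) - cst (f xstar) w)).
Proof. exact: (integrableB measurableT (ifX t) (integrable_cst_prob P _)). Qed.

Let E_diff t : \int[P]_w (f (X t w) - cst (f xstar) w) =
  \int[P]_w f (X t w) - f xstar.
Proof.
by rewrite RintegralB//; [rewrite Rintegral_prob_cst|exact: integrable_cst_prob].
Qed.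

Let E_gap_ge t : - (L / 2 * mu ^+ 2) <= \int[P]_w f (X t w) - f xstar.
Proof.
rewrite -E_diff -[leLHS](Rintegral_prob_cst P).
apply: ae_le_Rintegral => //; first exact: integrable_cst_prob.
by apply: ae_imp X_ball _ => w /(_ t)/smooth_gap_le; rewrite ler_norml => /andP[].
Qed.

(** Jensen's inequality for the concave power [r], from the tangent at the value
    [m t], which is positive and at least the mean of the squared gradient. *)
Let E_gap_le t : `|\int[P]_w f (X t w) - f xstar| <= C1 * m t `^ r.
Proof.
have mt0 := m_gt0 t; have /andP[r0 r1] := r01.
rewrite -E_diff.
have iabs : P.-integrable setT (EFin \o (fun w => `|f (X t w) - cst (f xstar) w|)).
  have := integrable_abse (idiff t); exact: eq_integrable.
apply: le_trans (le_normr_Rintegral measurableT (idiff t)) _.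
pose q : R := C1 * m t `^ r.
have q0 : 0 < q by rewrite mulr_gt0// powR_gt0.
have iY1 : P.-integrable setT (EFin \o (fun w => q * r / m t * gg t w)).
  have := integrableZl measurableT (q * r / m t) (igg t).
  by apply: eq_integrable => // w _; rewrite /= EFinM.
have iY : P.-integrable setT
    (EFin \o (fun w => q * r / m t * gg t w + cst (q * (1 - r)) w)).
  exact: (integrableD measurableT iY1 (integrable_cst_prob P _)).
apply: le_trans (_ : \int[P]_w (q * r / m t * gg t w + cst (q * (1 - r)) w) <= _).
  apply: ae_le_Rintegral => //.
  apply: ae_imp X_ball _ => w /(_ t) /grad_dominates h; apply: le_trans h _.
  rewrite -/(g t w) -/(gg t w).
  have g0 : 0 <= gg t w by exact: dot_ge0.
  have -> : gg t w `^ r = m t `^ r * (gg t w / m t) `^ r.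
    by rewrite -powRM ?divr_ge0 ?(ltW mt0)// mulrC divfK ?gt_eqF.
  have h := powR_le_tangent1 (gg t w / m t) r (divr_ge0 g0 (ltW mt0)).
  rewrite mulrA -/q; apply: le_trans (_ : q * (1 + r * (gg t w / m t - 1)) <= _).
    by rewrite ler_pM2l// h// r1 ltW.
  by rewrite le_eqVlt /cst; apply/orP; left; apply/eqP; ring.
rewrite RintegralD//; last exact: integrable_cst_prob.
rewrite Rintegral_prob_cst RintegralZl//; last exact: igg.
have : \int[P]_w gg t w / m t <= 1.
  by rewrite ler_pdivrMr// mul1r /m lerDl sqr_ge0.
move=> h; have {}h : q * r * (\int[P]_w gg t w / m t) <= q * r * 1.
  by rewrite ler_wpM2l// mulr_ge0// ltW.
rewrite -/q; move: h; rewrite mulrA [q * r / m t * _]mulrAC; lra.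
Qed.

Let Z_m t : `|Z t| <= (C1 + a) * m t `^ r.
Proof.
have /andP[r0 r1] := r01.
apply: le_trans (ler_normD _ _) _; rewrite mulrDl lerD ?E_gap_le//.
have ad0 : 0 <= a * delta t ^+ 2 by apply: mulr_ge0; [exact: ltW|exact: sqr_ge0].
rewrite (ger0_norm ad0) ler_pM2l//.
apply: le_trans (_ : (delta t ^+ 2) `^ r <= _).
  by rewrite ger1_powR// exprn_gt0//= expr_le1// ltW.
apply: ge0_ler_powR; rewrite ?nnegrE ?sqr_ge0 ?(ltW r0) ?(ltW (m_gt0 t))//.
by rewrite lerDr.
Qed.

Let Z_lb t : - (L / 2 * mu ^+ 2) <= Z t.
Proof.
by apply: le_trans (E_gap_ge t) _; rewrite lerDl mulr_ge0 ?sqr_ge0//; exact: ltW.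
Qed.

Variable xinf : {RV P >-> borel_mx R n 1}.
Hypothesis X_lim : {ae P, forall w, X t w @[t --> \oo] --> (xinf w : 'cV[R]_n)}.

(** Dominated convergence: the distances are bounded by twice the radius. *)
Lemma E_limit_le t (K : R) :
  (forall T, (t <= T)%N -> \int[P]_w enorm (X t w - X T w) <= K) ->
  ('E_P[fun w => enorm (X t w - xinf w)] <= K%:E)%E.
Proof.
move=> hK.
pose f_ (T : nat) w : \bar R := (enorm (X t w - X T w))%:E.
pose f0 w : \bar R := (enorm (X t w - (xinf w : 'cV[R]_n)))%:E.
have mxinf : measurable_fun setT (xinf : Omega -> borel_mx R n 1).
  exact: measurable_funPT.
have mf0 : measurable_fun setT f0.
  apply/measurable_EFinP; apply: measurable_enorm; apply: measurable_mxB => //.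
  exact: measurable_iterate.
have mf_ T : measurable_fun setT (f_ T).
  by apply/measurable_EFinP; exact: integrable_measurable (integrable_dist t T).
have cf : {ae P, forall w, setT w -> f_ ^~ w @ \oo --> f0 w}.
  apply: ae_imp X_lim _ => w h _; apply: cvg_EFin; first exact: nearW.
  apply: (continuous_cvg _ (continuous_enorm _)); apply: cvgB => //.
  exact: cvg_cst.
have bf : {ae P, forall w T, setT w -> (`|f_ T w| <= cst (mu + mu)%:E w)%E}.
  apply: ae_imp X_ball _ => w h T _; rewrite /f_/= lee_fin ger0_norm ?enorm_ge0//.
  rewrite -(subrKA xstar) (le_trans (ler_enormD _ _))// lerD//.
  by rewrite enormBC.
have [_ _ lim_f] := dominated_convergence measurableT mf_ mf0 cf
  (integrable_cst_prob P (mu + mu)) bf.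
rewrite unlock; apply: (cvge_to_le lim_f); exists t => // T /= tT.
rewrite -(fineK (integrable_fin_num measurableT (integrable_dist t T))) lee_fin.
exact: hK.
Qed.


Lemma E_dist_limit_le theta t : 0 < theta < 1 -> r * theta = 2^-1 ->
  ('E_P[fun w => enorm (X t w - xinf w)] <=
   (D * ((C1 + a) `^ theta / (c / 2 * (1 - theta))) * Z t `^ (1 - theta))%:E)%E.
Proof.
move=> th rth; apply: E_limit_le => T tT; apply: le_trans (E_dist_le t T tT) _.
have /andP[r0 _] := r01.
rewrite -mulrA ler_wpM2l//; first by rewrite !mulr_ge0 ?sqrtr_ge0// ltW.
apply: (sum_sqrt_driver_le m Z (c / 2) (C1 + a) r _ _ _ r0 _ Z_decr Z_m Z_lb) => //.
  by rewrite divr_gt0.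
exact: addr_gt0.
Qed.

(** [E |x_t - x_oo|] is at most a multiple of [sqrt (Z t)], which is
    [O (rho ^+ t)] with [rho ^+ 2 = q].  Taking [Q] with [Q * rho = sqrt rho]
    leaves a vanishing geometric factor. *)
Lemma geometric_rate : r = 1 -> exists2 Q : R, 1 < Q &
  ('E_P[fun w => (Q ^+ t * enorm (X t w - xinf w))%R])%E @[t --> \oo] --> 0%E.
Proof.
move=> r1; have /andP[r0 _] := r01.
have c20 : 0 < c / 2 by rewrite divr_gt0.
have Ca0 : 0 < C1 + a by exact: addr_gt0.
have [q /andP[q0 q1] Zq] := energy_geometric m Z (c / 2) (C1 + a) r _
  c20 Ca0 r0 m_gt0 Z_decr Z_m Z_lb r1.
have Z0 : 0 < Z 0.
  exact: energy_gt0 m Z (c / 2) (C1 + a) r _ c20 Ca0 r0 m_gt0 Z_decr Z_m Z_lb 0%N.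
have th01 : 0 < (2^-1 : R) < 1 by lra.
pose K : R := D * ((C1 + a) `^ 2^-1 / (c / 2 * (1 - 2^-1))).
have K0 : 0 <= K.
  rewrite /K mulr_ge0 ?divr_ge0 ?powR_ge0//.
    by rewrite !mulr_ge0 ?sqrtr_ge0// ltW.
  by rewrite mulr_ge0 ?(ltW c20)//; lra.
pose rho := Num.sqrt q; pose sigma := Num.sqrt rho.
have rho0 : 0 < rho by rewrite sqrtr_gt0.
have sigma0 : 0 < sigma by rewrite sqrtr_gt0.
have sqr_lt1 (u : R) : 0 < u -> u < 1 -> Num.sqrt u < 1.
  by move=> u0 u1; rewrite -[ltRHS]sqrtr1 ltr_sqrt.
have sigma1 : sigma < 1 by rewrite sqr_lt1// sqr_lt1.
exists sigma^-1; first by rewrite invf_gt1.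
apply: (@squeeze_cvge _ _ _ _ (cst 0%E) _
  (fun t => (K * Num.sqrt (Z 0) * sigma ^+ t)%R%:E)).
- apply: nearW => t; apply/andP; split.
    apply: expectation_ge0 => w.
    by rewrite mulr_ge0 ?enorm_ge0// exprn_ge0// invr_ge0 ltW.
  have -> : ('E_P[fun w => (sigma^-1 ^+ t * enorm (X t w - xinf w))%R] =
      (sigma^-1 ^+ t)%R%:E * 'E_P[fun w => enorm (X t w - xinf w)])%E.
    rewrite unlock -ge0_integralZl//.
    - apply/measurable_EFinP; apply: measurable_enorm; apply: measurable_mxB.
        exact: measurable_iterate.
      exact: measurable_funPT.
    - by move=> w _; rewrite lee_fin enorm_ge0.
    - by rewrite lee_fin exprn_ge0// invr_ge0 ltW.
  apply: le_trans (_ : ((sigma^-1 ^+ t)%R%:E * (K * Z t `^ (1 - 2^-1))%R%:E <= _)%E).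
    apply: lee_wpmul2l; first by rewrite lee_fin exprn_ge0// invr_ge0 ltW.
    by apply: E_dist_limit_le => //; rewrite r1 mul1r.
  rewrite -EFinM lee_fin.
  have -> : 1 - 2^-1 = 2^-1 :> R by lra.
  have Zt0 : 0 <= Z t.
    exact: ltW (energy_gt0 m Z (c / 2) (C1 + a) r _
      c20 Ca0 r0 m_gt0 Z_decr Z_m Z_lb t).
  rewrite powR12_sqrt//.
  have sq : Num.sqrt (Z t) <= Num.sqrt (Z 0) * (sigma ^+ t * sigma ^+ t).
    have -> : sigma ^+ t * sigma ^+ t = Num.sqrt (q ^+ t).
      rewrite -expr2 -exprM mulnC exprM sqr_sqrtr ?(ltW rho0)//.
      rewrite -[q](sqr_sqrtr (ltW q0)) -/rho -exprM mulnC exprM sqrtr_sqr.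
      by rewrite ger0_norm// exprn_ge0// ltW.
    rewrite -sqrtrM ?(ltW Z0)// ler_wsqrtr//; exact: Zq.
  apply: le_trans (_ : sigma^-1 ^+ t *
      (K * (Num.sqrt (Z 0) * (sigma ^+ t * sigma ^+ t))) <= _).
    rewrite ler_wpM2l ?exprn_ge0 ?invr_ge0 ?(ltW sigma0)//.
    by rewrite ler_wpM2l.
  rewrite exprVn le_eqVlt; apply/orP; left; apply/eqP; field.
  by rewrite gt_eqF// exprn_gt0.
- exact: cvg_cst.
- apply: cvg_EFin; first exact: nearW.
  rewrite -[X in _ --> X](mulr0 (K * Num.sqrt (Z 0))).
  apply: cvgM; first exact: cvg_cst.
  by apply: cvg_expr; rewrite gtr0_norm.
Qed.

Lemma polynomial_rate theta : 1 / 2 < theta < 1 -> r * theta = 2^-1 ->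
  exists2 C : R, 0 < C & \forall t \near \oo,
    ('E_P[fun w => enorm (X t w - xinf w)] <=
     (C * t%:R `^ ((1 - theta) / (1 - 2 * theta)))%:E)%E.
Proof.
move=> th rth; have /andP[r0 _] := r01; have /andP[th0 th1] := th.
have c20 : 0 < c / 2 by rewrite divr_gt0.
have Ca0 : 0 < C1 + a by exact: addr_gt0.
have [K K0 ZK] := energy_polynomial m Z (c / 2) (C1 + a) r _
  c20 Ca0 r0 m_gt0 Z_decr Z_m Z_lb theta th rth.
have th01 : 0 < theta < 1 by lra.
pose K' : R := D * ((C1 + a) `^ theta / (c / 2 * (1 - theta))).
have D0 : 0 < D.
  apply: mulr_gt0 => //; apply: mulr_gt0 => //.
  by rewrite sqrtr_gt0 addr_gt0// mulr_gt0 ?ltr0n// exprn_gt0.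
have K'0 : 0 < K'.
  apply: mulr_gt0 => //; apply: divr_gt0; first exact: powR_gt0.
  by apply: mulr_gt0 => //; lra.
exists (K' * K); first exact: mulr_gt0.
exists 1%N => // t /= t0.
apply: le_trans (E_dist_limit_le _ _ th01 rth) _.
rewrite lee_fin -/K' -mulrA ler_pM2l//.
exact: ZK.
Qed.

End Process.

(** * Lojasiewicz inequalities solved for the gap *)

Section LojasiewiczDomination.
Context {R : realType} {n : nat}.
Variables (f : 'cV[R]_n -> R) (xstar : 'cV[R]_n) (theta kappa mu : R).
Hypotheses (theta0 : 0 < theta) (kappa0 : 0 < kappa).
Hypothesis loj : lojasiewicz_at theta f xstar kappa mu.

(** On a set where the gap is bounded, an exponent below [1/2] can be raised to
    [1/2]: the surplus power of the gap is at most a power of its bound. *)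
Lemma lojasiewicz_square_domination (M : R) : theta <= 1 / 2 -> 0 < M ->
  (forall y, enorm (y - xstar) <= mu -> `|f y - f xstar| <= M) ->
  exists2 C1, 0 < C1 & forall y, enorm (y - xstar) <= mu ->
    `|f y - f xstar| <= C1 * dot (grad f y) (grad f y) `^ 1.
Proof.
move=> th M0 fM.
exists (kappa ^+ 2 * M `^ (1 - 2 * theta)).
  by rewrite mulr_gt0 ?exprn_gt0// powR_gt0.
move=> y hy; rewrite powRr1 ?dot_ge0// -sqr_enorm.
have := fM y hy; have := loj y hy; set F := `|_ - _|; set G := enorm _ => h FM.
have F0 : 0 <= F by exact: normr_ge0.
have G0 : 0 <= G by exact: enorm_ge0.
rewrite mulrAC -exprMn.
have [F_eq0|Fn0] := eqVneq F 0.
  by rewrite F_eq0 mulr_ge0 ?sqr_ge0 ?powR_ge0.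
have -> : F = (F `^ theta) ^+ 2 * F `^ (1 - 2 * theta).
  rewrite -powR_mulrn ?powR_ge0// -powRrM -powRD; last by rewrite Fn0 implybT.
  by rewrite [theta * _]mulrC subrKC powRr1.
apply: ler_pM; rewrite ?sqr_ge0 ?powR_ge0//.
  by rewrite ler_sqr// nnegrE ?powR_ge0// mulr_ge0// ltW.
apply: ge0_ler_powR; rewrite ?nnegrE//; [lra|exact: ltW].
Qed.

Lemma lojasiewicz_power_domination :
  exists2 C1, 0 < C1 & forall y, enorm (y - xstar) <= mu ->
    `|f y - f xstar| <= C1 * dot (grad f y) (grad f y) `^ (2 * theta)^-1.
Proof.
exists (kappa `^ theta^-1); first by rewrite powR_gt0.
move=> y hy; have := loj y hy; set F := `|_ - _| => h.
have F0 : 0 <= F by exact: normr_ge0.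
have -> : F = (F `^ theta) `^ theta^-1.
  by rewrite -powRrM divff ?gt_eqF// powRr1.
have -> : dot (grad f y) (grad f y) `^ (2 * theta)^-1 =
    enorm (grad f y) `^ theta^-1.
  by rewrite invfM powRrM powR12_sqrt ?dot_ge0// -enormE.
rewrite -powRM ?enorm_ge0 ?(ltW kappa0)//.
apply: ge0_ler_powR => //; rewrite ?nnegrE ?powR_ge0 ?invr_ge0 ?(ltW theta0)//.
by rewrite mulr_ge0 ?enorm_ge0// ltW.
Qed.

End LojasiewiczDomination.

(** * Convergence rates *)

Theorem theorem5 (R : realType) (n k : nat) (hk : (1 <= k <= n)%N)
  (f : 'cV[R]_n -> R) (L theta : R)
  (d : measure_display) (Omega : measurableType d) (P : probability Omega R)
  (V : nat -> {RV P >-> borel_mx R n k})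
  (x0 : 'cV[R]_n) (delta0 : R) (eta : nat -> R)
  (x : nat -> Omega -> 'cV[R]_n)
  (xinf : {RV P >-> borel_mx R n 1})
  (eta_lo eta_hi : R)
  (* the SZGD iterates *)
  (hVunif : forall t, uniform_stiefel (distribution P (V t)))
  (hVindep : mutually_independent P (fun t => V t : Omega -> borel_mx R n k))
  (hdelta0 : 0 < delta0 <= 1)
  (heta : forall t, 0 < eta t)
  (hx : forall t w, x t w = szgd f eta delta0 x0 (fun s => V s w) t)
  (* standing assumptions *)
  (hL : 0 < L) (hsmooth : smooth L f)
  (hloj : lojasiewicz theta f)
  (hinf : has_lbound (range f))
  (hiso : forall y, critical f y -> isolated (critical f) y)
  (hball : exists (xstar : 'cV[R]_n) (kappa mu : R),
     [/\ critical f xstar, 0 < kappa, 0 < mu,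
         lojasiewicz_at theta f xstar kappa mu &
         {ae P, forall w, forall t, enorm (x t w - xstar) <= mu}])
  (* the almost sure limit *)
  (hlim : {ae P, forall w, x t w @[t --> \oo] --> (xinf w : 'cV[R]_n)})
  (* step sizes *)
  (heta_lo : 0 < eta_lo) (heta_hi : 0 < eta_hi)
  (hetab : forall t, eta_lo <= eta t <= eta_hi) :
  (theta <= 1 / 2 ->
   -1 <= L * n%:R * eta_lo ^+ 2 / (2 * k%:R) - eta_lo < 0 ->
   -1 <= L * n%:R * eta_hi ^+ 2 / (2 * k%:R) - eta_hi < 0 ->
   exists2 Q : R, 1 < Q &
     ('E_P[fun w => (Q ^+ t * enorm (x t w - xinf w))%R])%E @[t --> \oo]
       --> 0%E)
  /\
  (1 / 2 < theta ->
   eta_lo < 2 * k%:R / (L * n%:R) ->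
   eta_hi < 2 * k%:R / (L * n%:R) ->
   exists2 C : R, 0 < C &
     \forall t \near \oo,
       ('E_P[fun w => enorm (x t w - xinf w)] <=
        (C * t%:R `^ ((1 - theta) / (1 - 2 * theta)))%:E)%E).
Proof.
have xE : x = fun t w => szgd f eta delta0 x0 (fun s => V s w) t.
  by apply/funext => t; apply/funext => w; exact: hx.
have [xstar [kap [mu [[_ gx0] kap0 mu0 hl xb]]]] := hball.
have [/andP[th0 th1] _ _] := hloj.
have /andP[k1 kn] := hk.
have k0 : 0 < k%:R :> R by rewrite ltr0n.
have n0 : 0 < n%:R :> R by rewrite ltr0n (leq_trans k1).
subst x.
split=> [th2 _ /andP[_ hhi]|th2 _ hhi].
- have small : L * (n%:R / k%:R) * eta_hi < 2.
    have E : L * n%:R * eta_hi ^+ 2 / (2 * k%:R) - eta_hi =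
        eta_hi / 2 * (L * (n%:R / k%:R) * eta_hi - 2).
      by field; rewrite gt_eqF.
    by move: hhi; rewrite E pmulr_rlt0 ?divr_gt0// subr_lt0.
  have M0 : 0 < L / 2 * mu ^+ 2 by rewrite mulr_gt0 ?divr_gt0 ?exprn_gt0.
  have [C1 C10 dom] := lojasiewicz_square_domination f xstar theta kap mu kap0
    hl (L / 2 * mu ^+ 2) th2 M0 (smooth_gap_le f L xstar mu hL hsmooth gx0 mu0).
  apply: (geometric_rate P f L V x0 delta0 eta eta_lo eta_hi xstar mu
    hk hVunif hVindep hdelta0 hL hsmooth gx0 mu0 xb heta_lo hetab small
    C1 1 C10 _ dom xinf hlim erefl).
  by rewrite ltr01 lexx.
- have small : L * (n%:R / k%:R) * eta_hi < 2.
    move: hhi; rewrite ltr_pdivlMr ?mulr_gt0// => hhi.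
    rewrite (_ : L * _ * _ = eta_hi * (L * n%:R) / k%:R); last by ring.
    by rewrite ltr_pdivrMr.
  have [C1 C10 dom] := lojasiewicz_power_domination f xstar theta kap mu th0 kap0 hl.
  apply: (polynomial_rate P f L V x0 delta0 eta eta_lo eta_hi xstar mu
    hk hVunif hVindep hdelta0 hL hsmooth gx0 mu0 xb heta_lo hetab small
    C1 (2 * theta)^-1 C10 _ dom xinf hlim theta).
  + by rewrite invr_gt0 mulr_gt0//= invf_le1 ?mulr_gt0//; lra.
  + by rewrite th2.
  + by field; rewrite gt_eqF.
Qed.
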